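(* Let $(X_n,\tilde X_n,\sigma_n)$ be generated by the expanding trust region truncated Robbins-Monro algorithm (defined in the context). Assume: (1) $f$ has a zero $x_\star$, and the trust regions are $U_n=B_{r_n}(0)$ with $0<r_0<r_1<r_2<\dots$ and $r_n\to\infty$. (2) For any $0<a<A$ there exists $\delta>0$ such that $\inf_{a\le\|x-x_\star\|\le A}\langle x-x_\star,f(x)\rangle\ge\delta$. (3) $x\mapsto\mathbb{E}[\|F(x,Z)\|^2]$ is bounded on bounded subsets of $\mathcal{H}$. (4) $a_n>0$ for all $n$, $\sum_n a_n=\infty$, and $\sum_n a_n^2<\infty$. Then, almost surely, $X_n\to x_\star$ in $\mathcal{H}$, and almost surely the number of truncations $\sup_n\sigma_n$ is finite.
   Context: $(\mathcal{H},\langle\cdot,\cdot\rangle,\|\cdot\|)$ is a separable Hilbert space and $B_r(x)$ is the open ball of radius $r$ about $x$. $\chi$ is an auxiliary measurable space, $Z$ is a $\chi$-valued random variable with law $\mu_Z$, and $F:\mathcal{H}\times\chi\to\mathcal{H}$ is (jointly) measurable, with $f:\mathcal{H}\to\mathcal{H}$ given by $f(x)=\mathbb{E}[F(x,Z)]=\int_\chi F(x,z)\,\mu_Z(dz)$ for all $x\in\mathcal{H}$. $Z_1,Z_2,\dots$ are i.i.d. with law $\mu_Z$ and $(a_n)_{n\ge1}$ is a deterministic real sequence. Expanding trust region algorithm: given open bounded sets $U_0\subsetneq U_1\subsetneq U_2\subsetneq\cdots$ with $\bigcup_n U_n=\mathcal{H}$, an initial point $X_0\in U_0$ (independent of $(Z_n)$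 if random) and $\sigma_0=0$, define for $n\ge0$ $$\tilde X_{n+1}=X_n-a_{n+1}F(X_n,Z_{n+1}),$$ and: if $\tilde X_{n+1}\in U_{\sigma_n}$, then $X_{n+1}=\tilde X_{n+1}$ and $\sigma_{n+1}=\sigma_n$; if $\tilde X_{n+1}\notin U_{\sigma_n}$ (a truncation), then $X_{n+1}=X_0^{(\sigma_n)}$ and $\sigma_{n+1}=\sigma_n+1$. The restart points $X_0^{(\sigma_n)}$ lie in $U_0$ and may be fixed or random, subject to $X_n$ being measurable with respect to $\mathcal{F}_n=\sigma(X_0,Z_1,\dots,Z_n)$ for every $n$; in particular $\mathbb{E}[F(X_n,Z_{n+1})\mid\mathcal{F}_n]=f(X_n)$. *)

(* Defs.v *)
From HB Require Import structures.
From mathcomp Require Import all_boot all_order all_algebra.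
From mathcomp Require Import all_classical all_reals all_analysis.

Set Implicit Arguments.
Unset Strict Implicit.
Unset Printing Implicit Defensive.

Import Order.TTheory GRing.Theory Num.Theory.
Import numFieldNormedType.Exports.

Local Open Scope classical_set_scope.
Local Open Scope ring_scope.

(* [H] carries its complete norm already; the inner product is a symmetric
   positive definite bilinear form inducing that norm. *)
Definition hilbert_norm (R : realType) (H : completeNormedModType R)
    (ip : {dot H for (@idfun R)}) : Prop :=
  forall x : H, `|x| = Num.sqrt (ip x x).

Definition separable (T : topologicalType) : Prop :=
  exists2 S : set T, countable S & dense S.

Notation borel H := (g_sigma_algebraType (@open H)).

Section bochner.
Context d (T : measurableType d) (R : realType) (H : completeNormedModType R).

Definition simple_fun (s : T -> H) : Prop :=
  finite_set (range s) /\ forall y, measurable (s @^-1` [set y]).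

Definition simple_integral (mu : probability T R) (s : T -> H) : H :=
  \sum_(y \in range s) fine (mu (s @^-1` [set y])) *: y.

(* [g] is Bochner integrable with integral [v].  In a separable [H], Borel
   measurability of [g] coincides with strong measurability. *)
Definition is_bochner_integral (mu : probability T R) (g : T -> H) (v : H) :
    Prop :=
  measurable_fun [set: T] (g : T -> borel H) /\
  exists s : nat -> T -> H,
    [/\ forall k, simple_fun (s k),
        (\int[mu]_t (`|g t - s k t|)%:E)%E @[k --> \oo] --> 0%E
      & simple_integral mu (s k) @[k --> \oo] --> v].

End bochner.

Section independence.
Context d (W : measurableType d) (R : realType) (P : probability W R).

Definition mutually_independent d' (T : measurableType d')
    (Y : nat -> W -> T) : Prop :=
  forall (J : seq nat) (B : nat -> set T), uniq J ->
    (forall j, measurable (B j)) ->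
    P (\bigcap_(j in [set` J]) (Y j @^-1` B j)) =
    (\prod_(j <- J) P (Y j @^-1` B j))%E.

Definition independent_sigma (G1 G2 : set (set W)) : Prop :=
  forall A B, G1 A -> G2 B -> P (A `&` B) = (P A * P B)%E.

End independence.

Section algorithm.
Context (R : realType) (H : completeNormedModType R).
Context d (W : measurableType d) (P : probability W R).
Context d' (chi : measurableType d').

Definition trust_regions (U : nat -> set H) : Prop :=
  [/\ forall n, open (U n),
      forall n, bounded_set (U n),
      forall n, U n `<` U n.+1
    & \bigcup_n U n = [set: H]].

(* The noise is [Z 1, Z 2, ...]; [Z 0] is never used. *)
Definition noise_sigma (Z : nat -> W -> chi) : set (set W) :=
  <<s \bigcup_(k in [set k | (1 <= k)%N]) g_sigma_algebra_preimage (Z k) >>.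

Definition history_sigma (X0 : W -> H) (Z : nat -> W -> chi) (n : nat) :
    set (set W) :=
  <<s g_sigma_algebra_preimage (X0 : W -> borel H) `|`
      \bigcup_(k in [set k | (1 <= k <= n)%N]) g_sigma_algebra_preimage (Z k) >>.

Definition iid_noise (muZ : set chi -> \bar R) (Z : nat -> {RV P >-> chi}) :
    Prop :=
  (forall n B, measurable B -> distribution P (Z n.+1) B = muZ B) /\
  mutually_independent P (fun n => Z n.+1 : W -> chi).

(* [Xres k] is the restart point used when the trust region index is [k].  Along
   a path the index [k] is left at the first truncation, so each [Xres k] is
   used at most once and may be an arbitrary function on the sample space, as
   long as [X] stays adapted.  [Xt 0] is irrelevant. *)
Record truncated_robbins_monro (U : nat -> set H) (a : nat -> R)
    (F : H * chi -> H) (Z : nat -> {RV P >-> chi})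
    (X Xt : nat -> W -> H) (sigma : nat -> W -> nat) : Prop := {
  trm_regions : trust_regions U ;
  trm_init_measurable : measurable_fun [set: W] (X 0%N : W -> borel H) ;
  trm_init_in : forall w, U 0%N (X 0%N w) ;
  trm_init_indep : independent_sigma P
    (g_sigma_algebra_preimage (X 0%N : W -> borel H)) (noise_sigma Z) ;
  trm_sigma0 : forall w, sigma 0%N w = 0%N ;
  trm_proposal : forall n w,
    Xt n.+1 w = X n w - a n.+1 *: F (X n w, Z n.+1 w) ;
  trm_accept : forall n w, U (sigma n w) (Xt n.+1 w) ->
    X n.+1 w = Xt n.+1 w /\ sigma n.+1 w = sigma n w ;
  trm_truncate : exists2 Xres : nat -> W -> H,
    forall k w, U 0%N (Xres k w)
    & forall n w, ~ U (sigma n w) (Xt n.+1 w) ->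
      X n.+1 w = Xres (sigma n w) w /\ sigma n.+1 w = (sigma n w).+1 ;
  trm_adapted : forall n (B : set (borel H)), measurable B ->
    history_sigma (X 0%N) Z n (X n @^-1` B)
}.

End algorithm.

(* Main.v *)
Require Import Defs.
From HB Require Import structures.
From mathcomp Require Import all_boot all_order all_algebra.
From mathcomp Require Import finmap.
From mathcomp Require Import all_classical all_reals all_analysis.
From mathcomp Require Import measurable_realfun ring lra.

(* With V_n = |X_n - x*|^2, a step that is not truncated reads
     V_{n+1} = V_n - 2 a_{n+1} <X_n - x*, f(X_n)> + e_n,
   where e_n is the sum of a martingale difference and of a_{n+1}^2 |F|^2.  Cut off
   where |X_n - x*| >= rho, the series of the e_n converges almost surely for every
   integer rho, whatever the truncations do; only scalar martingales occur.  The
   rest is pathwise.  After a late restart the drift is nonnegative and the tail of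
   the noise is small, so the path stays in a ball contained in the current trust
   region and is never truncated again.  From then on V_n minus the noise is
   nonincreasing, so V_n converges, and its limit is 0 because the drift is bounded
   below away from x* while the steps have infinite sum. *)

Set Implicit Arguments.
Unset Strict Implicit.
Unset Printing Implicit Defensive.

Import Order.TTheory GRing.Theory Num.Theory.
Import numFieldNormedType.Exports.

Local Open Scope classical_set_scope.
Local Open Scope ring_scope.

(** * Pathwise analysis *)

(** The obstacle is a circle: moments of the noise are controlled only while the path is bounded,
    and boundedness of the path is what has to be shown. The cutoff breaks it because it depends on
    [X n] alone and so is known before [Z n.+1] is drawn: it keeps the increments centred and makes
    their variance of order [a n.+1 ^+ 2]. Integer radii leave countably many null sets, so the
    radius may be chosen after the sample point. It is chosen twice: from [r 0] and the norm of
    [xstar], to show that truncations stop, and from the final trust region, to show convergence.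
    Since every restart lies in the fixed set [U 0], the first radius does not depend on when the
    restart happens, and one can wait until the noise tail is small and the trust region is
    large. *)

Lemma cvgn_bounded (R : realType) (u : nat -> R) : cvgn u ->
  exists2 M : R, 0 < M & forall n, `|u n| <= M.
Proof.
move=> /cvg_seq_bounded/pinfty_ex_gt0[M M0 uM].
by exists M => // n; exact: uM.
Qed.

Lemma cvgn_increments_small (R : realType) (u : nat -> R) (eps : R) :
  0 < eps -> cvgn u ->
  exists N, forall m n, (N <= m)%N -> (N <= n)%N -> `|u m - u n| < eps.
Proof.
move=> eps0 /cvg_ex[l ul].
have e2 : 0 < eps / 2 by rewrite divr_gt0.
have [N _ NP] := (cvgrPdist_lt _ _).1 ul _ e2.
exists N => m n Nm Nn.
have := NP m Nm; have := NP n Nn; rewrite /= => h1 h2.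
have -> : u m - u n = (l - u n) - (l - u m) by ring.
apply: le_lt_trans (ler_normB _ _) _.
by rewrite [ltRHS](splitr eps) ltrD.
Qed.

Lemma descent_cvg0 (R : realType) (V S h a : nat -> R) :
  (forall n, 0 <= V n) -> (forall n, 0 <= a n) ->
  (forall n, 0 <= h n) -> cvgn S ->
  (forall n, V n.+1 - S n.+1 = V n - S n - a n * h n) ->
  (forall b A, 0 < b -> b < A -> exists2 delta, 0 < delta &
     forall n, b <= V n <= A -> delta <= h n) ->
  (fun n => \sum_(0 <= k < n) a k) @ \oo --> +oo ->
  V n @[n --> \oo] --> 0.
Proof.
move=> V0 a0 h0 cS VS drift asum.
pose u n := V n - S n.
have [M M0 SM] := cvgn_bounded cS.
have uM n : - M <= u n.
  by have := SM n; rewrite ler_norml => /andP[_ ?]; have := V0 n; rewrite /u; lra.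
have uS n : u n.+1 = u n - a n * h n by rewrite /u VS.
have ndu : nonincreasing_seq u.
  by apply/nonincreasing_seqP => n; rewrite uS gerBl mulr_ge0.
have cu : cvgn u.
  by apply: nonincreasing_is_cvgn => //; exists (- M) => _ [n _ <-].
have /cvg_ex[L VL] : cvgn V.
  have -> : V = u + S by apply/funext => n; rewrite fctE /u subrK.
  exact: is_cvgD.
have L0 : 0 <= L.
  by rewrite -(cvg_lim _ VL)//; apply: limr_ge; [exact: cvgP VL|exact: nearW].
have [<-//|Lneq0] := eqVneq L 0.
have Lgt0 : 0 < L by rewrite lt_neqAle eq_sym Lneq0.
(* A window around the presumed positive limit: [V n] is eventually within [L / 2] of [L], hence
   between these two bounds. *)
have [||delta delta0 Hd] := drift (L / 2) (2 * L).
- by rewrite divr_gt0.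
- lra.
have L2 : 0 < L / 2 by rewrite divr_gt0.
have [N _ NP] := (cvgrPdist_lt _ _).1 VL _ L2.
have hN n : (N <= n)%N -> delta <= h n.
  move=> Nn; apply: Hd; have := NP n Nn; rewrite /= ltr_distlC => /andP[? ?].
  by apply/andP; split; lra.
have uD n : u (N + n)%N <= u N - delta * \sum_(N <= k < N + n) a k.
  elim: n => [|n IH]; first by rewrite addn0 big_geq// mulr0 subr0.
  rewrite addnS uS big_nat_recr ?leq_addr//= mulrDr opprD addrA.
  apply: lerB => //; rewrite mulrC ler_wpM2l//.
  by apply: hN; rewrite leq_addr.
(* The threshold makes the steps after [N] sum to at least [(u N + M + 1) / delta], which pushes [u]
   down to [- M - 1], below its lower bound [- M]. *)
move/cvgryPge : asum => /(_ (\sum_(0 <= k < N) a k + (u N + M + 1) / delta)).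
move=> [n0 _ Hn0].
have := Hn0 (N + n0)%N (leq_addl _ _) => /=.
have -> : \sum_(0 <= k < N + n0) a k =
    \sum_(0 <= k < N) a k + \sum_(N <= k < N + n0) a k.
  by rewrite -big_cat_nat// leq_addr.
rewrite lerD2l ler_pdivrMr// mulrC => h1.
by have := uD n0; have := uM (N + n0)%N; lra.
Qed.

Section truncated_path.
Context (R : realType) (H : normedModType R).
Variables (X Xt Xres : nat -> H) (sigma : nat -> nat) (r a : nat -> R).
Variables (xstar : H) (h : H -> R) (e : nat -> nat -> R).
Hypothesis r_infty : r n @[n --> \oo] --> +oo.
Hypothesis X0_in : ball (0 : H) (r 0%N) (X 0%N).
Hypothesis accept : forall n, ball (0 : H) (r (sigma n)) (Xt n.+1) ->
  X n.+1 = Xt n.+1 /\ sigma n.+1 = sigma n.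
Hypothesis Xres_in : forall k, ball (0 : H) (r 0%N) (Xres k).
Hypothesis truncate : forall n, ~ ball (0 : H) (r (sigma n)) (Xt n.+1) ->
  X n.+1 = Xres (sigma n) /\ sigma n.+1 = (sigma n).+1.
Hypothesis a_gt0 : forall n, 0 < a n.
Hypothesis a_sum : (fun n => \sum_(0 <= k < n) a k) @ \oo --> +oo.
Hypothesis h_ge0 : forall x, 0 <= h x.
Hypothesis h_drift : forall b A, 0 < b -> b < A -> exists2 delta, 0 < delta &
  forall x, b <= `|x - xstar| <= A -> delta <= h x.
(** For each radius [rho], the sequence [e rho] has to describe the proposal only while the path is
    within [rho] of [xstar]; elsewhere it is constrained only by the convergence of its series. *)
Hypothesis e_cvg : forall rho, cvgn (fun n => \sum_(0 <= k < n) e rho k).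
Hypothesis proposal : forall rho k, `|X k - xstar| < rho%:R ->
  `|Xt k.+1 - xstar| ^+ 2 = `|X k - xstar| ^+ 2 - a k * h (X k) + e rho k.

Let ball_dist_lt k x : ball (0 : H) (r k) x -> `|x - xstar| < r k + `|xstar|.
Proof.
rewrite -ball_normE/= sub0r normrN => xk.
by rewrite (le_lt_trans (ler_normB _ _))// ltrD2r.
Qed.

Lemma truncation_step n :
  sigma n.+1 = sigma n /\ X n.+1 = Xt n.+1 /\ ball (0 : H) (r (sigma n)) (X n.+1)
  \/ sigma n.+1 = (sigma n).+1 /\ ball (0 : H) (r 0%N) (X n.+1).
Proof.
have [B|B] := pselect (ball (0 : H) (r (sigma n)) (Xt n.+1)).
  by left; have [-> ->] := accept B.
by right; have [-> ->] := truncate B; split.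
Qed.

Lemma truncations_bounded : exists B, forall n, (sigma n <= B)%N.
Proof.
apply: contrapT => nB.
have unb B : exists n, (B < sigma n)%N.
  apply: contrapT => /forallNP hn; apply: nB; exists B => n.
  by rewrite leqNgt; apply/negP/hn.
(* Every restart point is within [c] of [xstar]. The radius [rho] adds a margin of 1, enough to
   absorb a noise contribution below 1 because [c ^+ 2 + 1 <= (c + 1) ^+ 2]. *)
pose c := r 0%N + `|xstar|.
have c0 : 0 < c.
  have := ball_dist_lt X0_in; exact: le_lt_trans.
pose rho := Num.bound `|c + 1|.
have crho : c + 1 < rho%:R.
  by rewrite /rho; apply: le_lt_trans (ler_norm _) (archi_boundP (normr_ge0 _)).
(* From index [K] on, each trust region contains the ball of radius [rho] about [xstar]. *)
have [K _ rK] := (cvgryPge _).1 r_infty (rho%:R + `|xstar|).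
have Kball k x : (K <= k)%N -> `|x - xstar| < rho%:R -> ball (0 : H) (r k) x.
  move=> Kk xr; rewrite -ball_normE/= sub0r normrN.
  have := rK k Kk => /=; apply: lt_le_trans.
  have := ler_normD (x - xstar) xstar; rewrite subrK => /le_lt_trans; apply.
  by rewrite ltrD2r.
pose S n := \sum_(0 <= k < n) e rho k.
have [N NP] := cvgn_increments_small (@ltr01 R) (@e_cvg rho).
have sigmaS n : (sigma n <= sigma n.+1)%N.
  by case: (truncation_step n) => -[-> _].
have sigma_mono : {homo sigma : m n / (m <= n)%N}.
  by apply: homo_leq => //; exact: leq_trans.
(* a truncation occurring once the noise tail and the trust region are under
   control *)
have [n0 [n0N n0K n0X]] : exists n0, [/\ (N <= n0)%N, (K <= sigma n0)%N &
    ball (0 : H) (r 0%N) (X n0)].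
  have [n1 n1P] := unb (sigma N + K)%N.
  apply: contrapT => nex.
  (* Up to time [N] this is monotonicity. Later, the first passage above this level would be a
     truncation after time [N] with index at least [K], which is excluded by assumption. *)
  have /(_ n1) : forall n, (sigma n <= sigma N + K)%N.
    elim=> [|n IH].
      by rewrite (leq_trans (sigma_mono _ _ (leq0n N)))// leq_addr.
    case: (truncation_step n) => [[-> _]//|[sn Xn]].
    have [nN|nN] := leqP N n.+1; last first.
      by rewrite (leq_trans (sigma_mono _ _ (ltnW nN)))// leq_addr.
    rewrite leqNgt; apply/negP => Hs; apply: nex; exists n.+1; split => //.
    by rewrite (leq_trans _ (ltnW Hs))// leq_addl.
  by rewrite leqNgt n1P.
(* As the drift is nonnegative, the squared distance grows by at most the noise accumulated since
   the restart. The bound and the absence of truncation go through one induction, since each needs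
   the other at the previous step. *)
have key n : `|X (n0 + n)%N - xstar| ^+ 2 <= c ^+ 2 + (S (n0 + n)%N - S n0) /\
    sigma (n0 + n)%N = sigma n0.
  have Sclose m : (n0 <= m)%N -> S m - S n0 < 1.
    move=> n0m; apply: le_lt_trans (ler_norm _) _.
    by apply: NP => //; exact: leq_trans n0m.
  have inrho m v : (n0 <= m)%N -> 0 <= v -> v ^+ 2 <= c ^+ 2 + (S m - S n0) ->
      v < rho%:R.
    move=> n0m v0 /le_lt_trans hv; apply: lt_trans crho.
    have c1 : 0 <= c + 1 by rewrite addr_ge0// ltW.
    rewrite -(@ltr_pXn2r _ 2)//.
    by apply: hv; have := Sclose m n0m; nra.
  elim: n => [|n [IH1 IH2]].
    rewrite addn0 subrr addr0; split => //.
    rewrite ler_pXn2r ?nnegrE ?(ltW c0)//; exact/ltW/ball_dist_lt.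
  rewrite addnS.
  have Xrho : `|X (n0 + n)%N - xstar| < rho%:R.
    by apply: inrho IH1; rewrite ?leq_addr.
  (* The bound is proved for the proposal, before its acceptance is known, and it is what forces the
     acceptance. *)
  have Xtle : `|Xt (n0 + n).+1 - xstar| ^+ 2 <= c ^+ 2 + (S (n0 + n).+1 - S n0).
    have -> : S (n0 + n).+1 = S (n0 + n)%N + e rho (n0 + n)%N.
      by rewrite /S big_nat_recr.
    rewrite (proposal Xrho).
    have := mulr_ge0 (ltW (a_gt0 (n0 + n))) (h_ge0 (X (n0 + n)%N)); lra.
  have Xtball : ball (0 : H) (r (sigma (n0 + n)%N)) (Xt (n0 + n).+1).
    apply: Kball; first by rewrite IH2.
    by apply: inrho Xtle => //; rewrite (leq_trans (leq_addr n n0)).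
  by have [-> ->] := accept Xtball.
have [n1 n1P] := unb (sigma n0).
have n01 : (n0 <= n1)%N.
  by rewrite leqNgt; apply/negP => /ltnW/sigma_mono; rewrite leqNgt n1P.
by have [_] := key (n1 - n0)%N; rewrite subnKC// => E; rewrite E ltnn in n1P.
Qed.

Lemma truncated_path_cvg : X n @[n --> \oo] --> xstar.
Proof.
have [B sB] := truncations_bounded.
have sigmaS n : (sigma n <= sigma n.+1)%N.
  by case: (truncation_step n) => -[-> _].
have sigma_mono : {homo sigma : m n / (m <= n)%N}.
  by apply: homo_leq => //; exact: leq_trans.
(* The least upper bound of [sigma] is attained, and from then on monotonicity keeps [sigma]
   constant. *)
have [N sN] : exists N, forall n, (N <= n)%N -> sigma n = sigma N.
  have exB : exists b, `[< forall n, (sigma n <= b)%N >].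
    by exists B; exact/asboolP.
  case: (ex_minnP exB) => b /asboolP hb bmin.
  have [N NP] : exists N, (b <= sigma N)%N.
    case: b hb bmin => [|b] hb bmin; first by exists 0%N.
    apply: contrapT => /forallNP hn.
    suff : (b.+1 <= b)%N by rewrite ltnn.
    apply: bmin; apply/asboolP => n; rewrite -ltnS ltnNge; exact/negP/hn.
  exists N => n Nn; apply/eqP; rewrite eqn_leq (sigma_mono _ _ Nn) andbT.
  exact: leq_trans (hb n) NP.
have step n : X (N + n).+1 = Xt (N + n).+1 /\
    ball (0 : H) (r (sigma N)) (X (N + n).+1).
  case: (truncation_step (N + n)%N); rewrite (sN _ (leq_addr n N)).
    by move=> [_ [-> ?]].
  by move=> [E _]; move: (sN (N + n).+1); rewrite E -addnS leq_addr => /(_ isT) /eqP;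
     rewrite -[X in _ == X]addn0 -addn1 eqn_add2l.
(* A second radius, independent of the one that stopped the truncations: it covers the final trust
   region, which holds all later iterates. *)
pose c := r (sigma N) + `|xstar|.
pose rho := Num.bound `|c|.
have crho : c < rho%:R.
  by rewrite /rho; apply: le_lt_trans (ler_norm _) (archi_boundP (normr_ge0 _)).
have inrho n : `|X (N + n).+1 - xstar| < rho%:R.
  by apply: lt_trans (ball_dist_lt _) crho; have [] := step n.
(* Shifted to [N.+1], because [step] places an iterate in the final region once it results from a
   proposal made at time [N] or later. *)
pose V n := `|X (N.+1 + n)%N - xstar| ^+ 2.
pose S n := \sum_(0 <= k < n) e rho k.
have V0 : V n @[n --> \oo] --> 0.
  apply: (@descent_cvg0 _ V (fun n => S (N.+1 + n)%N) (fun n => h (X (N.+1 + n)%N))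
    (fun n => a (N.+1 + n)%N)).
  - by move=> n; rewrite /V sqr_ge0.
  - by move=> n; exact/ltW.
  - by move=> n; exact: h_ge0.
  - apply/cvg_ex; have /cvg_ex[l Sl] := @e_cvg rho; exists l.
    under eq_fun do rewrite addnC.
    by have := Sl; rewrite -(cvg_shiftn N.+1).
  - move=> n; rewrite /V addnS.
    have [] := step n.+1; rewrite addnS => -> _.
    rewrite addSn (@proposal rho)//.
    by rewrite /S [X in _ - X]big_nat_recr//=; ring.
  - move=> b A b0 bA.
    have A0 : 0 < A by exact: lt_trans bA.
    (* [V] is a squared distance while [h_drift] speaks of distances, hence the square roots. *)
    have [||delta d0 Hd] := h_drift (b := Num.sqrt b) (A := Num.sqrt A).
    + by rewrite sqrtr_gt0.
    + by rewrite ltr_sqrt.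
    exists delta => // n /andP[bV VA]; apply: Hd; apply/andP; split.
      by rewrite -[leRHS]ger0_norm// -sqrtr_sqr ler_sqrt// exprn_ge0.
    by rewrite -[leLHS]ger0_norm// -sqrtr_sqr ler_sqrt// (ltW A0).
  - apply/cvgryPge => M.
    have [n0 _ Hn0] := (cvgryPge _).1 a_sum (M + \sum_(0 <= k < N.+1) a k).
    exists n0 => // n /= n0n.
    have := Hn0 (n + N.+1)%N (leq_trans n0n (leq_addr _ _)) => /=.
    have -> : \sum_(0 <= k < n + N.+1) a k =
        \sum_(N.+1 <= k < n + N.+1) a k + \sum_(0 <= k < N.+1) a k.
      by rewrite [RHS]addrC -big_cat_nat// leq_addl.
    rewrite lerD2r.
    by rewrite -{1}[N.+1]add0n big_addn addnK; under eq_bigr do rewrite addnC.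
rewrite -(cvg_shiftn N.+1); apply/cvgrPdist_lt => eps eps0.
have e2 : 0 < eps ^+ 2 by rewrite exprn_gt0.
apply: filterS ((cvgrPdist_lt _ _).1 V0 _ e2) => n /=.
rewrite sub0r normrN ger0_norm ?sqr_ge0// /V addnC distrC.
by rewrite ltr_pXn2r ?nnegrE// ltW.
Qed.

End truncated_path.

(** * Square-integrable martingales *)

Lemma g_sigma_algebra_measurable_funS d d' (W : measurableType d)
    (T : measurableType d') (G : set (set W)) (f : W -> T) :
  G `<=` measurable ->
  measurable_fun [set: g_sigma_algebraType G] f -> measurable_fun [set: W] f.
Proof.
move=> Gm mf _ B mB; have := mf measurableT B mB; rewrite !setTI.
by apply: smallest_sub => //; exact: sigma_algebra_measurable.
Qed.

Lemma g_sigma_algebra_measurable_fun_le (W : pointedType) d'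
    (T : measurableType d') (G1 G2 : set (set W)) (f : W -> T) :
  <<s G1 >> `<=` <<s G2 >> ->
  measurable_fun [set: g_sigma_algebraType G1] f ->
  measurable_fun [set: g_sigma_algebraType G2] f.
Proof. by move=> G12 mf _ B mB; apply: G12; exact: mf. Qed.

Lemma integrable_of_sqr d (T : measurableType d) (R : realType)
    (mu : probability T R) (f : T -> R) :
  measurable_fun setT f -> (\int[mu]_t ((f t) ^+ 2)%:E < +oo)%E ->
  mu.-integrable setT (fun t => (f t)%:E).
Proof.
move=> mf foo.
have if2 : mu.-integrable setT (fun t => ((f t) ^+ 2)%:E).
  apply/integrableP; split; first by apply/measurable_EFinP; exact: measurable_funX.
  by under eq_integral do rewrite gee0_abs ?lee_fin ?sqr_ge0//.
apply: (@le_integrable _ _ _ mu setT measurableT _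
    (fun t => 1%:E + ((f t) ^+ 2)%:E)%E).
- exact/measurable_EFinP.
- move=> t _; rewrite -EFinD !abse_EFin lee_fin [leRHS]ger0_norm ?addr_ge0 ?sqr_ge0//.
  by have := real_normK (num_real (f t)); nra.
- by apply: integrableD => //; exact: finite_measure_integrable_cst.
Qed.

Section square_integrable_martingale.
Context d (W : measurableType d) (R : realType) (P : probability W R).
Variables (G : nat -> set (set W)) (D : nat -> W -> R) (v : nat -> R).
Hypothesis Gm : forall k, G k `<=` measurable.
Hypothesis G_mono : forall k, <<s G k >> `<=` <<s G k.+1 >>.
Hypothesis D_adapted : forall k,
  measurable_fun [set: g_sigma_algebraType (G k.+1)] (D k).
Hypothesis D_var : forall k, (\int[P]_w ((D k w) ^+ 2)%:E <= (v k)%:E)%E.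
(** The martingale difference property in weak form, without conditional expectations: orthogonality
    to bounded functions of the past. *)
Hypothesis D_orth : forall k (Y : W -> R) M,
  measurable_fun [set: g_sigma_algebraType (G k)] Y ->
  (forall w, `|Y w| <= M) -> (\int[P]_w (Y w * D k w)%:E = 0)%E.
Hypothesis v_sum : (\sum_(0 <= k <oo) (v k)%:E < +oo)%E.

Let v_ge0 k : 0 <= v k.
Proof.
rewrite -lee_fin (le_trans _ (D_var k))// integral_ge0// => w _.
by rewrite lee_fin sqr_ge0.
Qed.

Let D_meas k : measurable_fun [set: W] (D k).
Proof. exact: g_sigma_algebra_measurable_funS (@D_adapted k). Qed.

Let D2_integrable k : P.-integrable setT (fun w => ((D k w) ^+ 2)%:E).
Proof.
apply/integrableP; split.
  by apply/measurable_EFinP; exact: measurable_funX.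
rewrite (le_lt_trans _ (ltry (v k)))// (le_trans _ (D_var k))//.
by under eq_integral do rewrite gee0_abs ?lee_fin ?sqr_ge0//.
Qed.

Let D_integrable k : P.-integrable setT (EFin \o D k).
Proof. by apply: integrable_of_sqr => //; exact: le_lt_trans (D_var k) (ltry _). Qed.

(* Freezing the partial sums when they first leave ]-eps, eps[ turns Kolmogorov's
   maximal inequality into Chebyshev's inequality for the last frozen sum. *)
Fixpoint stopped_sum (m : nat) (eps : R) (n : nat) (w : W) : R :=
  if n is n'.+1 then
    stopped_sum m eps n' w +
    (if `|stopped_sum m eps n' w| < eps then D (m + n') w else 0)
  else 0.

Lemma stopped_sum_adapted m eps n :
  measurable_fun [set: g_sigma_algebraType (G (m + n))] (stopped_sum m eps n).
Proof.
elim: n => [|n IH]; first exact: measurable_cst.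
rewrite addnS /=.
have IH' := g_sigma_algebra_measurable_fun_le (@G_mono (m + n)) IH.
apply: measurable_funD => //; apply: measurable_fun_ifT => //.
apply: measurable_fun_ltr => //.
exact: measurableT_comp.
Qed.

Lemma stopped_sum_measurable m eps n : measurable_fun [set: W] (stopped_sum m eps n).
Proof. exact: g_sigma_algebra_measurable_funS (@stopped_sum_adapted m eps n). Qed.

Lemma stopped_sum_var m eps n :
  (\int[P]_w ((stopped_sum m eps n w) ^+ 2)%:E <=
   (\sum_(m <= k < m + n) v k)%:E)%E.
Proof.
elim: n => [|n IH].
  rewrite addn0 big_geq//=.
  by rewrite expr0n/= integral0.
set T := stopped_sum m eps n in IH *.
have mT : measurable_fun setT T by exact: stopped_sum_measurable.
(* The next frozen sum has square [T ^+ 2 + Y * D + E ^+ 2]. Freezing bounds [Y] by twice [eps], so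
   [D_orth] kills the cross term although the last jump may leave [T] unbounded. *)
pose Y w := if `|T w| < eps then 2 * T w else 0.
pose E w := if `|T w| < eps then D (m + n) w else 0.
have mlt : measurable_fun [set: W] (fun w => `|T w| < eps).
  by apply: measurable_fun_ltr => //; exact: measurableT_comp.
have mY : measurable_fun [set: g_sigma_algebraType (G (m + n))] Y.
  have mT' : measurable_fun [set: g_sigma_algebraType (G (m + n))] T.
    exact: stopped_sum_adapted.
  apply: measurable_fun_ifT => //; last exact: measurable_funM.
  by apply: measurable_fun_ltr => //; exact: measurableT_comp.
have mE : measurable_fun setT E by exact: measurable_fun_ifT.
have Yb w : `|Y w| <= 2 * `|eps|.
  rewrite /Y; case: ifP => [h|_]; last by rewrite normr0 mulr_ge0.
  by rewrite normrM ger0_norm// ler_wpM2l// (le_trans (ltW h))// ler_norm.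
have iT : P.-integrable setT (fun w => ((T w) ^+ 2)%:E).
  apply/integrableP; split.
    by apply/measurable_EFinP; exact: measurable_funX.
  rewrite (le_lt_trans _ (ltry (\sum_(m <= k < m + n) v k)))// (le_trans _ IH)//.
  by under eq_integral do rewrite gee0_abs ?lee_fin ?sqr_ge0//.
have iYD : P.-integrable setT (fun w => (Y w * D (m + n) w)%:E).
  apply: (@le_integrable _ _ _ P setT measurableT _
    (fun w => (2 * `|eps|)%:E * (EFin \o D (m + n)) w)%E).
  - apply/measurable_EFinP; apply: measurable_funM => //.
    exact: g_sigma_algebra_measurable_funS mY.
  - move=> w _; rewrite /= lee_fin !normrM ler_wpM2r//.
    by rewrite -normrM (le_trans (Yb w))// ler_norm.
  - exact: integrableZl.
have iE : P.-integrable setT (fun w => ((E w) ^+ 2)%:E).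
  apply: le_integrable (@D2_integrable (m + n)) => //.
    by apply/measurable_EFinP; exact: measurable_funX.
  move=> w _; rewrite !abse_EFin lee_fin /E; case: ifP => // _.
  by rewrite expr0n/= normr0.
have -> : (\int[P]_w ((stopped_sum m eps n.+1 w) ^+ 2)%:E =
    \int[P]_w ((((T w) ^+ 2)%:E + (Y w * D (m + n) w)%:E) + ((E w) ^+ 2)%:E))%E.
  apply: eq_integral => w _; rewrite -!EFinD; congr EFin.
  by rewrite /= -/T /Y /E; case: ifP => _; ring.
rewrite integralD//; last exact: integrableD.
rewrite integralD// (D_orth mY Yb) adde0 addnS big_nat_recr ?leq_addr//= EFinD.
apply: leeD => //; apply: le_trans (D_var (m + n)).
apply: ge0_le_integral => //.
- by move=> w _; rewrite lee_fin sqr_ge0.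
- exact: measurable_int iE.
- exact: measurable_int (@D2_integrable (m + n)).
- move=> w _; rewrite lee_fin /E; case: ifP => // _.
  by rewrite expr0n/= sqr_ge0.
Qed.

(** The right-hand side does not depend on [n], so [n] can go to infinity first and [m]
    afterwards. *)
Lemma stopped_sum_chebyshev m (eps : R) n : 0 < eps ->
  ((eps ^+ 2)%:E * P [set w | eps <= `|stopped_sum m eps n w|]%R <=
   \sum_(m <= k <oo) (v k)%:E)%E.
Proof.
move=> eps0.
apply: (@le_trans _ _ (\sum_(m <= k < m + n) v k)%:E); last first.
  rewrite -sumEFin; apply: nneseries_lim_ge => k _ _.
  by rewrite lee_fin.
apply: le_trans (stopped_sum_var m eps n).
have mT := @stopped_sum_measurable m eps n.
have mA : measurable [set w | eps <= `|stopped_sum m eps n w|].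
  rewrite -[X in measurable X]setTI.
  have -> : [set w | eps <= `|stopped_sum m eps n w|] =
    (fun w => `|stopped_sum m eps n w|) @^-1` `[eps, +oo[%classic.
    by apply/seteqP; split => w /=; rewrite in_itv/= andbT.
  by apply: (measurableT_comp _ mT).
rewrite -integral_cst//.
apply: (@le_trans _ _ (\int[P]_(w in [set w | eps <= `|stopped_sum m eps n w|]%R)
    ((stopped_sum m eps n w) ^+ 2)%:E)%E).
  apply: ge0_le_integral => //.
  - by move=> w _; rewrite lee_fin sqr_ge0.
  - by apply/measurable_EFinP; apply: measurable_funX; exact: measurable_funTS.
  - move=> w /= ew; rewrite lee_fin -[leRHS]real_normK ?num_real//.
    by rewrite ler_pXn2r ?nnegrE// ltW.
apply: ge0_subset_integral => //.
- by apply/measurable_EFinP; exact: measurable_funX.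
- by move=> w _; rewrite lee_fin sqr_ge0.
Qed.

Lemma stopped_sum_escape m (eps : R) n w : 0 < eps ->
  eps <= `|\sum_(m <= k < m + n) D k w| ->
  exists n', eps <= `|stopped_sum m eps n' w|.
Proof.
move=> eps0 h; apply: contrapT => /forallNP nex.
suff E j : stopped_sum m eps j w = \sum_(m <= k < m + j) D k w.
  by apply: (nex n); rewrite E.
elim: j => [|j IH]; first by rewrite addn0 big_geq.
rewrite /= addnS big_nat_recr ?leq_addr//= -IH.
by have /negP := nex j; rewrite -ltNge => ->.
Qed.

(** Once the level is reached the sum no longer moves. Continuity from below then carries the bound
    at a fixed [n] over to the union, that is, to all times at once. *)
Lemma stopped_sum_frozen m (eps : R) :
  nondecreasing_seq (fun n => [set w | eps <= `|stopped_sum m eps n w|]).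
Proof.
apply/nondecreasing_seqP => n; apply/subsetPset => u /= h.
by rewrite ltNge h/= addr0.
Qed.

(** Each union has probability at most a tail of the variance series divided by [eps ^+ 2], and
    these tails tend to 0. *)
Lemma martingale_escape_negligible (eps : R) : 0 < eps ->
  P.-negligible (\bigcap_m \bigcup_n
    [set w | eps <= `|stopped_sum m eps n w|]).
Proof.
move=> eps0.
pose A m n := [set w | eps <= `|stopped_sum m eps n w|].
have mA m n : measurable (A m n).
  rewrite /A -[X in measurable X]setTI.
  have -> : [set w | eps <= `|stopped_sum m eps n w|] =
    (fun w => `|stopped_sum m eps n w|) @^-1` `[eps, +oo[%classic.
    by apply/seteqP; split => w /=; rewrite in_itv/= andbT.
  by apply: (measurableT_comp _ (stopped_sum_measurable m eps n)).
have mB m : measurable (\bigcup_n A m n) by exact: bigcupT_measurable.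
apply/negligibleP; first exact: bigcapT_measurable.
apply/eqP; rewrite eq_le measure_ge0 andbT.
have bound m : ((eps ^+ 2)%:E * P (\bigcap_m \bigcup_n A m n) <=
    \sum_(m <= k <oo) (v k)%:E)%E.
  apply: (@le_trans _ _ ((eps ^+ 2)%:E * P (\bigcup_n A m n))%E).
    rewrite lee_pmul2l ?fin_numE// ?lte_fin ?exprn_gt0//.
    by rewrite le_measure ?inE//; [exact: bigcapT_measurable|exact: bigcap_inf].
  have cv : P (A m n) @[n --> \oo] --> P (\bigcup_n A m n).
    by apply: nondecreasing_cvg_mu => //; exact: stopped_sum_frozen.
  have {}cv : ((eps ^+ 2)%:E * P (A m n))%E @[n --> \oo] -->
      ((eps ^+ 2)%:E * P (\bigcup_n A m n))%E by exact: cvgeZl.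
  rewrite -(cvg_lim _ cv)//; apply: lime_le; first exact: cvgP cv.
  by apply: nearW => n; exact: stopped_sum_chebyshev.
have tail := nneseries_tail_cvg v_sum (fun k _ => v_ge0 k).
have : ((eps ^+ 2)%:E * P (\bigcap_m \bigcup_n A m n) <= 0)%E.
  rewrite -(cvg_lim _ tail)//; apply: lime_ge; first exact: cvgP tail.
  exact: nearW.
by rewrite pmule_rle0// lte_fin exprn_gt0.
Qed.

Lemma martingale_cvg :
  {ae P, forall w, cvgn (fun n => \sum_(0 <= k < n) D k w)}.
Proof.
(* The levels [j.+1%:R^-1] are countably many, which gives one null set, and they suffice for the
   Cauchy criterion. *)
have : {ae P, forall w j, ~ (\bigcap_m \bigcup_n
    [set w | j.+1%:R^-1 <= `|stopped_sum m j.+1%:R^-1 n w|]) w}.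
  apply: ae_foralln => j.
  have j0 : 0 < j.+1%:R^-1 :> R by rewrite invr_gt0 ltr0n.
  apply: negligibleS (martingale_escape_negligible j0).
  by move=> w /= /contrapT.
apply: filterS => w hw.
apply/cauchy_cvgP/cauchy_exP => e e0.
pose j := Num.truncn e^-1.
have je : j.+1%:R^-1 < e.
  by rewrite invf_plt ?posrE// ?ltr0n// truncnS_gt.
have [m hm] : exists m, ~ (\bigcup_n
    [set w | j.+1%:R^-1 <= `|stopped_sum m j.+1%:R^-1 n w|]) w.
  by apply/existsNP => h; apply: (hw j) => m _; exact: h.
exists (\sum_(0 <= k < m) D k w); exists m => // n /= mn.
rewrite -ball_normE/=; apply: lt_trans je.
rewrite ltNge; apply/negP => h; apply: hm.
have [] := @stopped_sum_escape m j.+1%:R^-1 (n - m) w.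
- by rewrite invr_gt0 ltr0n.
- rewrite subnKC//; apply: le_trans h _; rewrite distrC.
  suff -> : \sum_(0 <= k < n) D k w =
      \sum_(0 <= k < m) D k w + \sum_(m <= k < n) D k w by rewrite addrAC subrr add0r.
  by rewrite -big_cat_nat.
- by move=> n' hn'; exists n'.
Qed.

End square_integrable_martingale.

(** * Independence *)

Section independent_pair.
Context d d1 d2 (W : measurableType d) (T1 : measurableType d1)
  (T2 : measurableType d2) (R : realType) (P : probability W R).
Variables (X : {RV P >-> T1}) (Y : {RV P >-> T2}).
Hypothesis indep : forall A B, measurable A -> measurable B ->
  P (X @^-1` A `&` Y @^-1` B) = (P (X @^-1` A) * P (Y @^-1` B))%E.

Let XY w := (X w, Y w).

Let mXY : measurable_fun [set: W] XY.
Proof. exact: measurable_fun_pair. Qed.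

HB.instance Definition _ := isMeasurableFun.Build _ _ _ _ XY mXY.

Lemma distribution_independent_pair C : measurable C ->
  (distribution P X \x distribution P Y)%E C = distribution P XY C.
Proof.
apply: product_measure_unique => A B mA mB.
by rewrite /= /pushforward -indep.
Qed.

Lemma ge0_integral_independent_pair (f : T1 * T2 -> \bar R) :
  measurable_fun setT f -> (forall z, 0 <= f z)%E ->
  (\int[P]_w f (X w, Y w) =
   \int[P]_w \int[distribution P Y]_y f (X w, y))%E.
Proof.
move=> mf f0.
have -> : (\int[P]_w f (X w, Y w) = \int[distribution P XY]_z f z)%E.
  by rewrite ge0_integral_distribution.
rewrite (eq_measure_integral (distribution P X \x distribution P Y)%E); last first.
  by move=> C mC _; exact/esym/distribution_independent_pair.
rewrite fubini_tonelli1//.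
rewrite (@ge0_integral_distribution _ _ _ _ _ _ X (fubini_F (distribution P Y) f))//.
- exact: measurable_fun_fubini_tonelli_F.
- by move=> x; exact: integral_ge0.
Qed.

Lemma integral_independent_pair (f : T1 * T2 -> \bar R) :
  measurable_fun setT f -> P.-integrable setT (fun w => f (X w, Y w)) ->
  (\int[P]_w f (X w, Y w) =
   \int[P]_w \int[distribution P Y]_y f (X w, y))%E.
Proof.
move=> mf intf.
have intf2 : (distribution P X \x distribution P Y)%E.-integrable setT f.
  apply/integrableP; split => //.
  rewrite (eq_measure_integral (distribution P XY)); last first.
    by move=> C mC _; exact: distribution_independent_pair.
  rewrite ge0_integral_distribution//; last exact: measurableT_comp.
  by case/integrableP : intf.
have -> : (\int[P]_w f (X w, Y w) = \int[distribution P XY]_z f z)%E.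
  by rewrite integral_distribution.
rewrite (eq_measure_integral (distribution P X \x distribution P Y)%E); last first.
  by move=> C mC _; exact/esym/distribution_independent_pair.
rewrite -integral12_prod_meas1//.
rewrite (@integral_distribution _ _ _ _ _ _ X (fubini_F (distribution P Y) f))//.
- exact: measurable_fubini_F intf2.
- have := integrable_fubini_F intf2.
  case/integrableP => mF Foo; apply/integrableP; split.
    by apply: measurableT_comp.
  by move: Foo; rewrite ge0_integral_distribution//; exact: measurableT_comp.
Qed.

End independent_pair.

(** As functions of [A] both sides are finite measures, the restriction of [P] to [D] and [P] scaled
    by the mass of [D]. They agree on a pi-system containing the whole space, hence on the
    sigma-algebra it generates. *)
Lemma independent_sigma_pi_system d (W : measurableType d) (R : realType)
    (P : probability W R) (C : set (set W)) (D : set W) :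
  C `<=` measurable -> setI_closed C -> C setT -> measurable D ->
  (forall A, C A -> P (A `&` D) = (P A * P D)%E) ->
  forall A, <<s C >> A -> P (A `&` D) = (P A * P D)%E.
Proof.
move=> Cm CI CT mD CD A sA.
pose c : {nonneg R} := NngNum (fine_ge0 (measure_ge0 P D)).
have h := @g_sigma_algebra_measure_unique _ R W C Cm (fun=> setT) (fun=> CT) _
  (mrestr P mD) (mscale c P) CI _ _ A sA.
have PD : (fine (P D))%:E = P D by rewrite fineK// fin_num_measure.
have E B : mscale c P B = (P B * P D)%E by rewrite /mscale /c /= PD muleC.
rewrite -E; apply: h.
- by apply/seteqP; split => // w _; exists 0%N.
- by move=> B CB; rewrite -[RHS]/(mscale c P B) E -CD.
- move=> _; suff : (P (setT `&` D) < +oo)%E by [].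
  by rewrite setTI (le_lt_trans (probability_le1 P mD)) ?ltry.
Qed.

Section history.
Context d (W : measurableType d) (R : realType) (P : probability W R).
Context (H : completeNormedModType R) d' (chi : measurableType d').
Variables (X0 : W -> H) (Z : nat -> {RV P >-> chi}).
Hypothesis mX0 : measurable_fun [set: W] (X0 : W -> borel H).
Hypothesis Z_indep : mutually_independent P (fun n => Z n.+1 : W -> chi).
Hypothesis X0_indep : independent_sigma P
  (g_sigma_algebra_preimage (X0 : W -> borel H)) (noise_sigma Z).

(** The generating family inside [history_sigma], named separately because [g_sigma_algebraType] is
    indexed by a generating family. *)
Definition history_generator (n : nat) : set (set W) :=
  g_sigma_algebra_preimage (X0 : W -> borel H) `|`
  \bigcup_(k in [set k | (1 <= k <= n)%N]) g_sigma_algebra_preimage (Z k).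

Lemma history_generator_measurable n : history_generator n `<=` measurable.
Proof.
move=> A [[B mB <-]|[k _ [B mB <-]]]; first exact: mX0.
exact: measurable_funP.
Qed.

Lemma history_sigma_le n :
  <<s history_generator n >> `<=` <<s history_generator n.+1 >>.
Proof.
apply: sub_smallest2r; first exact: smallest_sigma_algebra.
move=> A [GA|[k /andP[k1 kn] GA]]; first by left.
by right; exists k => //=; rewrite k1 leqW.
Qed.

(** Cylinder events of the first [n] noise variables; the numbering is shifted, [B j] constraining
    [Z j.+1]. *)
Let past (B : nat -> set chi) n := \bigcap_(j in [set` iota 0 n]) (Z j.+1 @^-1` B j).

Let iotaSr n : iota 0 n.+1 = rcons (iota 0 n) n.
Proof. by rewrite -cats1 -[in LHS]addn1 iotaD. Qed.

Let pastS B n : past B n.+1 = past B n `&` Z n.+1 @^-1` B n.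
Proof.
rewrite /past iotaSr; apply/seteqP; split => [w h|w [h1 h2] j].
  split; last by apply: h; rewrite /= mem_rcons mem_head.
  by move=> j jn; apply: h; rewrite /= mem_rcons inE; apply/orP; right.
by rewrite /= mem_rcons inE => /orP[/eqP ->//|]; exact: h1.
Qed.

Let past_noise B n : (forall j, measurable (B j)) -> noise_sigma Z (past B n).
Proof.
move=> mB; rewrite /noise_sigma.
set G := (X in <<s X >>).
elim: n => [|n IH].
  rewrite (_ : past B 0 = setT); first exact: (@measurableT _ (g_sigma_algebraType G)).
  by apply/seteqP; split => // w _ j.
rewrite pastS; apply: (@measurableI _ (g_sigma_algebraType G)) => //.
by apply: sub_sigma_algebra; exists n.+1 => //; exists (B n) => //; rewrite setTI.
Qed.

Let past_indep B n : (forall j, measurable (B j)) ->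
  P (past B n.+1) = (P (past B n) * P (Z n.+1 @^-1` B n))%E.
Proof.
move=> mB; rewrite /past !Z_indep ?iota_uniq//.
by rewrite iotaSr -cats1 big_cat big_seq1.
Qed.

Lemma history_noise_independent n A B : history_sigma X0 Z n A -> measurable B ->
  P (A `&` Z n.+1 @^-1` B) = (P A * P (Z n.+1 @^-1` B))%E.
Proof.
move=> hA mB.
(* Initial events cut with noise cylinders form a pi-system whose sigma-algebra contains the
   history. On it the claim splits into the independence of [X0] from the noise and that of the
   noise variables among themselves. *)
pose C := [set A | exists A0 B', [/\ g_sigma_algebra_preimage (X0 : W -> borel H) A0,
  (forall j, measurable (B' j)) & A = A0 `&` past B' n]].
have noise_meas A' : noise_sigma Z A' -> measurable A'.
  apply: smallest_sub; first exact: sigma_algebra_measurable.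
  by move=> _ [k _ [B' mB' <-]]; exact: measurable_funP.
have T0 : g_sigma_algebra_preimage (X0 : W -> borel H) setT.
  by exists setT => //; rewrite setTI preimage_setT.
have pastT : past (fun=> setT) n = setT by apply/seteqP; split => // w _ j _.
apply: (@independent_sigma_pi_system _ _ _ _ C) => //.
- move=> _ [A0 [B' [[B0 mB0 <-] mB' ->]]]; apply: measurableI; first exact: mX0.
  by apply: noise_meas; exact: past_noise.
- move=> _ _ [A0 [B0 [[D0 mD0 <-] mB0 ->]]] [A1 [B1 [[D1 mD1 <-] mB1 ->]]].
  exists (X0 @^-1` (D0 `&` D1)), (fun j => B0 j `&` B1 j); split.
  + by exists (D0 `&` D1); [exact: measurableI|rewrite setTI].
  + by move=> j; exact: measurableI.
  + rewrite !setTI setIACA; congr (_ `&` _).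
    apply/seteqP; split => [w [h0 h1] j jn|w h]; first by split; [exact: h0|exact: h1].
    by split => j jn; have [] := h j jn.
- by exists setT, (fun=> setT); split => //; rewrite pastT setTI.
- by rewrite -[X in measurable X]setTI; exact: measurable_funP.
- move=> _ [A0 [B' [gA0 mB' ->]]].
  (* The event on the fresh noise becomes one more factor of the cylinder, in position [n], which
     [past_indep] can split off. *)
  pose B2 j := if j == n then B else B' j.
  have mB2 j : measurable (B2 j) by rewrite /B2; case: ifP.
  have E : past B2 n = past B' n.
    by apply/seteqP; split => w h j jn; have := h j jn; rewrite /B2;
      rewrite /= mem_iota add0n in jn; rewrite ltn_eqF.
  have E2 : past B2 n.+1 = past B' n `&` Z n.+1 @^-1` B.
    by rewrite pastS E /B2 eqxx.
  rewrite -setIA -E2 X0_indep//; last exact: past_noise.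
  rewrite past_indep// E X0_indep//; last exact: past_noise.
  by rewrite /B2 eqxx muleA.
- apply: sub_smallest2r hA; first exact: smallest_sigma_algebra.
  move=> A' [gA'|[k /andP[k1 kn] [B' mB' <-]]].
    by exists A', (fun=> setT); split => //; rewrite pastT setIT.
  (* A generator coming from [Z k] is the cylinder constrained in position [k.-1] only. *)
  exists setT, (fun j => if j.+1 == k then B' else setT); split => //.
    by move=> j; case: ifP.
  rewrite !setTI; apply/seteqP; split => [w /= Bw j jn|w h] /=.
    by case: eqP => //= ->.
  have := h k.-1; rewrite /= prednK// eqxx; apply.
  by rewrite mem_iota add0n prednK.
Qed.

End history.

(** * Random series driven by fresh noise *)

Section adapted_noise.
Context d (W : measurableType d) (R : realType) (P : probability W R).
Context d1 (T1 : measurableType d1) d2 (chi : measurableType d2).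
Variables (G : nat -> set (set W)) (X : nat -> W -> T1) (Z : nat -> {RV P >-> chi}).
Variable mu : probability chi R.
Hypothesis Gm : forall k, G k `<=` measurable.
Hypothesis G_mono : forall k, <<s G k >> `<=` <<s G k.+1 >>.
Hypothesis X_adapted : forall k,
  measurable_fun [set: g_sigma_algebraType (G k)] (X k).
Hypothesis Z_adapted : forall k,
  measurable_fun [set: g_sigma_algebraType (G k.+1)] (Z k.+1).
Hypothesis Z_law : forall k B, measurable B -> distribution P (Z k.+1) B = mu B.
Hypothesis Z_indep : forall k A B, <<s G k >> A -> measurable B ->
  P (A `&` Z k.+1 @^-1` B) = (P A * P (Z k.+1 @^-1` B))%E.

(* The identity as a random variable in [W] equipped with the past: its independence
   from the fresh noise reduces conditional expectations to Fubini. *)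
Let past k (w : W) : g_sigma_algebraType (G k) := w.

Let mpast k : measurable_fun [set: W] (past k).
Proof.
move=> _ B mB; rewrite setTI; apply: smallest_sub mB => //.
exact: sigma_algebra_measurable.
Qed.

HB.instance Definition _ k := isMeasurableFun.Build _ _ _ _ (past k) (@mpast k).

Lemma ge0_integral_fresh_noise k (f : g_sigma_algebraType (G k) * chi -> \bar R) :
  measurable_fun setT f -> (forall z, 0 <= f z)%E ->
  (\int[P]_w f (w, Z k.+1 w) = \int[P]_w \int[mu]_z f (w, z))%E.
Proof.
move=> mf f0.
rewrite (@ge0_integral_independent_pair _ _ _ _ _ _ _ P (past k) (Z k.+1))//.
  apply: eq_integral => w _; apply: eq_measure_integral => B mB _.
  exact: Z_law.
by move=> A B mA mB; exact: Z_indep.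
Qed.

(** The integrand may depend on the whole past and not just on [X k]. This leaves room for the
    bounded past-measurable factor of the orthogonality relation. *)
Lemma integral_fresh_noise k (f : g_sigma_algebraType (G k) * chi -> \bar R) :
  measurable_fun setT f -> P.-integrable setT (fun w => f (w, Z k.+1 w)) ->
  (\int[P]_w f (w, Z k.+1 w) = \int[P]_w \int[mu]_z f (w, z))%E.
Proof.
move=> mf intf.
rewrite (@integral_independent_pair _ _ _ _ _ _ _ P (past k) (Z k.+1))//.
  apply: eq_integral => w _; apply: eq_measure_integral => B mB _.
  exact: Z_law.
by move=> A B mA mB; exact: Z_indep.
Qed.

Let mXz k : measurable_fun [set: g_sigma_algebraType (G k) * chi]
  (fun wz : g_sigma_algebraType (G k) * chi => (X k wz.1, wz.2)).
Proof.
apply: measurable_fun_pair; last exact: measurable_snd.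
exact: (measurableT_comp (@X_adapted k) measurable_fst).
Qed.

Lemma fresh_noise_adapted k d3 (T3 : measurableType d3) (phi : T1 * chi -> T3) :
  measurable_fun setT phi ->
  measurable_fun [set: g_sigma_algebraType (G k.+1)] (fun w => phi (X k w, Z k.+1 w)).
Proof.
move=> mphi; apply: (measurableT_comp mphi); apply: measurable_fun_pair => //.
exact: g_sigma_algebra_measurable_fun_le (@G_mono k) _.
Qed.

Lemma fresh_noise_measurable k d3 (T3 : measurableType d3) (phi : T1 * chi -> T3) :
  measurable_fun setT phi ->
  measurable_fun [set: W] (fun w => phi (X k w, Z k.+1 w)).
Proof.
move=> mphi.
apply: (g_sigma_algebra_measurable_funS (@Gm k.+1)).
exact: fresh_noise_adapted.
Qed.

Lemma ge0_integral_fresh_noise_le k (psi : T1 * chi -> R) C :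
  measurable_fun setT psi -> (forall u, 0 <= psi u) ->
  (forall x, \int[mu]_z (psi (x, z))%:E <= C%:E)%E ->
  (\int[P]_w (psi (X k w, Z k.+1 w))%:E <= C%:E)%E.
Proof.
move=> mpsi psi0 psiC.
rewrite (@ge0_integral_fresh_noise k
  (fun wz => (psi (X k wz.1, wz.2))%:E)); last 2 first.
- by apply/measurable_EFinP; exact: (measurableT_comp mpsi (@mXz k)).
- by move=> z; rewrite lee_fin.
have C0 : (0 <= C%:E)%E.
  apply: le_trans (psiC (X k point)).
  by apply: integral_ge0 => z _; rewrite lee_fin.
rewrite -[leRHS]mule1 -(@probability_setT _ _ _ P) -integral_cst//.
apply: ge0_le_integral => //.
- by move=> w _; apply: integral_ge0 => z _; rewrite lee_fin.
- have mF := @measurable_fun_fubini_tonelli_F _ _ (g_sigma_algebraType (G k)) chi R mu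
    (fun wz => (psi (X k wz.1, wz.2))%:E).
  apply: g_sigma_algebra_measurable_funS (mF _ _) => //.
  + by apply/measurable_EFinP; exact: (measurableT_comp mpsi (@mXz k)).
  + by move=> z; rewrite lee_fin.
- by move=> w _ /=; exact: (psiC (X k w)).
Qed.

(** Integrating over the fresh noise with the past held fixed makes products with functions of the
    past vanish, and bounds the variance of the [k]-th term by [(a k) ^+ 2 * C]. *)
Lemma fresh_noise_martingale_cvg (phi : T1 * chi -> R) C (a : nat -> R) :
  measurable_fun setT phi ->
  (forall x, \int[mu]_z ((phi (x, z)) ^+ 2)%:E <= C%:E)%E ->
  (forall x, \int[mu]_z (phi (x, z))%:E = 0)%E ->
  (\sum_(0 <= k <oo) ((a k) ^+ 2)%:E < +oo)%E ->
  {ae P, forall w,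
    cvgn (fun n => \sum_(0 <= k < n) a k * phi (X k w, Z k.+1 w))}.
Proof.
move=> mphi phiC phi0 asum.
have C0 : 0 <= C.
  rewrite -lee_fin; apply: le_trans (phiC (X 0 point)).
  by apply: integral_ge0 => z _; rewrite lee_fin sqr_ge0.
pose D k w := a k * phi (X k w, Z k.+1 w).
have mD k : measurable_fun [set: g_sigma_algebraType (G k.+1)] (D k).
  by apply: measurable_funM => //; exact: fresh_noise_adapted.
have D2 k : (\int[P]_w ((D k w) ^+ 2)%:E <= ((a k) ^+ 2 * C)%:E)%E.
  rewrite /D; under eq_integral do rewrite exprMn EFinM.
  have m2 : measurable_fun [set: W] (fun w => ((phi (X k w, Z k.+1 w)) ^+ 2)%:E).
    by apply/measurable_EFinP; apply: measurable_funX; exact: fresh_noise_measurable.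
  rewrite ge0_integralZl//; last 2 first.
  - by move=> w _; rewrite lee_fin sqr_ge0.
  - by rewrite lee_fin sqr_ge0.
  rewrite [leRHS]EFinM lee_wpmul2l ?lee_fin ?sqr_ge0//.
  apply: (@ge0_integral_fresh_noise_le k (fun u => (phi u) ^+ 2)) => //.
  - exact: measurable_funX.
  - by move=> u; exact: sqr_ge0.
apply: (@martingale_cvg _ _ _ P G D (fun k => (a k) ^+ 2 * C)) => //.
- move=> k Y M mY YM.
  have mDW : measurable_fun [set: W] (D k).
    exact: g_sigma_algebra_measurable_funS (mD k).
  have iD : P.-integrable setT (fun w => (D k w)%:E).
    by apply: integrable_of_sqr => //; rewrite (le_lt_trans (D2 k))// ltry.
  rewrite (@integral_fresh_noise k
    (fun wz => (Y wz.1 * (a k * phi (X k wz.1, wz.2)))%:E)); last 2 first.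
  + apply/measurable_EFinP; apply: measurable_funM => //.
      by apply: measurableT_comp => //; exact: measurable_fst.
    by apply: measurable_funM => //; exact: (measurableT_comp mphi (@mXz k)).
  + apply: (@le_integrable _ _ _ P setT measurableT _
      (fun w => (`|M|)%:E * (D k w)%:E)%E).
    * apply/measurable_EFinP; apply: measurable_funM => //.
      exact: g_sigma_algebra_measurable_funS mY.
    * move=> w _; rewrite -EFinM !abse_EFin lee_fin !normrM normr_id.
      by rewrite -/(D k w) -normrM ler_wpM2r// (le_trans (YM w))// ler_norm.
    * exact: integrableZl.
  rewrite (eq_integral (fun=> 0%E)) ?integral0// => w _ /=.
  under eq_integral do rewrite mulrA EFinM.
  rewrite integralZl ?phi0 ?mule0//.
  apply: integrable_of_sqr; last by rewrite (le_lt_trans (phiC _))// ltry.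
  exact: measurable_fun_pair2.
- under eq_eseriesr do rewrite mulrC EFinM.
  rewrite nneseriesZl; last by move=> k _; rewrite lee_fin sqr_ge0.
  by rewrite lte_mul_pinfty.
Qed.

(** By monotone convergence the expectation of the full series is at most [C] times the sum of the
    [b k], so the series is finite almost surely. *)
Lemma fresh_noise_series_cvg (psi : T1 * chi -> R) C (b : nat -> R) :
  measurable_fun setT psi -> (forall u, 0 <= psi u) -> (forall k, 0 <= b k) ->
  (forall x, \int[mu]_z (psi (x, z))%:E <= C%:E)%E ->
  (\sum_(0 <= k <oo) (b k)%:E < +oo)%E ->
  {ae P, forall w,
    cvgn (fun n => \sum_(0 <= k < n) b k * psi (X k w, Z k.+1 w))}.
Proof.
move=> mpsi psi0 b0 psiC bsum.
have C0 : 0 <= C.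
  rewrite -lee_fin; apply: le_trans (psiC (X 0 point)).
  by apply: integral_ge0 => z _; rewrite lee_fin.
pose g k w := (b k * psi (X k w, Z k.+1 w))%:E.
have g0 k w : (0 <= g k w)%E by rewrite lee_fin mulr_ge0.
have mg k : measurable_fun setT (g k).
  apply/measurable_EFinP; apply: measurable_funM => //.
  exact: fresh_noise_measurable.
have intfin : (\int[P]_w (\sum_(k <oo) g k w) < +oo)%E.
  rewrite integral_nneseries//.
  apply: (@le_lt_trans _ _ (\sum_(0 <= k <oo) (C%:E * (b k)%:E))%E).
    apply: lee_nneseries => k _; first by move=> _; apply: integral_ge0.
    rewrite /g; under eq_integral do rewrite EFinM.
    rewrite ge0_integralZl//; last 3 first.
    - by apply/measurable_EFinP; exact: fresh_noise_measurable.
    - by move=> w _; rewrite lee_fin.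
    - by rewrite lee_fin.
    by rewrite muleC lee_wpmul2r ?lee_fin//; exact: ge0_integral_fresh_noise_le.
  rewrite nneseriesZl; last by move=> k _; rewrite lee_fin.
  by rewrite lte_mul_pinfty.
have ig : P.-integrable setT (fun w => \sum_(k <oo) g k w)%E.
  apply/integrableP; split; first by apply: ge0_emeasurable_sum.
  under eq_integral do rewrite gee0_abs ?nneseries_ge0//.
  exact: intfin.
apply: filterS (integrable_ae measurableT ig) => w /(_ I) fin.
apply: nondecreasing_is_cvgn.
  apply/nondecreasing_seqP => n; rewrite big_nat_recr//= lerDl.
  by rewrite mulr_ge0.
exists (fine (\sum_(k <oo) g k w)%E) => _ [n _ <-].
by rewrite -lee_fin fineK// -sumEFin; apply: nneseries_lim_ge => k _ _; exact: g0.
Qed.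

End adapted_noise.

(** * Hilbert space integrals *)

Section inner_product.
Context (R : realType) (H : completeNormedModType R) (ip : {dot H for (@idfun R)}).
Hypothesis Hhilbert : hilbert_norm ip.

Lemma ipC (x y : H) : ip x y = ip y x.
Proof. by rewrite (hermC ip)/= expr0 mul1r. Qed.

Lemma ipZl c (x y : H) : ip (c *: x) y = c * ip x y.
Proof. exact: linearZl_LR. Qed.

Lemma ipZr c (x y : H) : ip x (c *: y) = c * ip x y.
Proof. by rewrite ipC ipZl ipC. Qed.

Lemma ip_ge0 (x : H) : 0 <= ip x x.
Proof.
have [->|x0] := eqVneq x 0; first by rewrite linear0r.
exact/ltW/neq0_dnorm_gt0.
Qed.

Lemma hilbert_normE (x : H) : `|x| ^+ 2 = ip x x.
Proof. by rewrite Hhilbert sqr_sqrtr// ip_ge0. Qed.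

Lemma hilbert_normD (x y : H) : `|x + y| ^+ 2 = `|x| ^+ 2 + 2 * ip x y + `|y| ^+ 2.
Proof.
rewrite !hilbert_normE linearDl/= !linearDr/= (ipC y x); ring.
Qed.

Lemma hilbert_normB (x y : H) : `|x - y| ^+ 2 = `|x| ^+ 2 - 2 * ip x y + `|y| ^+ 2.
Proof.
by rewrite hilbert_normD linearNr/= normrN; ring.
Qed.

Lemma hilbert_CauchySchwarz (x y : H) : `|ip x y| <= `|x| * `|y|.
Proof.
have [->|y0] := eqVneq y 0; first by rewrite linear0r !normr0 mulr0.
have y2 : 0 < `|y| ^+ 2 by rewrite exprn_gt0// normr_gt0.
rewrite -(@ler_pXn2r _ 2) ?nnegrE ?mulr_ge0// exprMn real_normK ?num_real//.
(* This vector is the component of [x] orthogonal to [y], multiplied by the squared norm of [y] to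
   avoid a division. *)
have : 0 <= `| `|y| ^+ 2 *: x - ip x y *: y | ^+ 2 by rewrite sqr_ge0.
rewrite hilbert_normB ipZl ipZr !normrZ !exprMn.
rewrite normr_id [ `|ip x y| ^+ 2]real_normK ?num_real//.
set u := `|x|; set v := `|y|; set p := ip x y => h.
have : 0 <= v ^+ 2 * (u ^+ 2 * v ^+ 2 - p ^+ 2).
  rewrite (_ : _ * _ = (v ^+ 2) ^+ 2 * u ^+ 2 - 2 * (v ^+ 2 * (p * p)) +
    p ^+ 2 * v ^+ 2) //; ring.
by rewrite pmulr_rge0// subr_ge0.
Qed.

(** Reduces the continuity of [ip] to that of the norm. *)
Lemma ip_polarization (x y : H) : ip x y = (`|x + y| ^+ 2 - `|x - y| ^+ 2) / 4.
Proof. by rewrite hilbert_normD hilbert_normB; field. Qed.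

Lemma ip_continuous : continuous (fun u : H * H => ip u.1 u.2).
Proof.
rewrite (_ : (fun u => _) = (fun u : H * H =>
  (`|u.1 + u.2| * `|u.1 + u.2| - `|u.1 - u.2| * `|u.1 - u.2|) * 4^-1)); last first.
  by apply/funext => u; rewrite ip_polarization !expr2.
move=> u; apply: cvgM; last exact: cvg_cst.
have c1 : (fun z : H * H => `|z.1 + z.2|) z @[z --> u] --> `|u.1 + u.2|.
  by apply: cvg_norm; apply: cvgD; [exact: cvg_fst|exact: cvg_snd].
have c2 : (fun z : H * H => `|z.1 - z.2|) z @[z --> u] --> `|u.1 - u.2|.
  by apply: cvg_norm; apply: cvgB; [exact: cvg_fst|exact: cvg_snd].
by apply: cvgB; exact: cvgM.
Qed.

End inner_product.

Section borel_product.
Context (R : realType) (H : completeNormedModType R).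
Hypothesis Hsep : separable H.

(** By separability an open set is a countable union of products of balls with centres in the dense
    set and rational radii. Hence continuous functions of two vectors are measurable for the product
    of the Borel sigma-algebras. *)
Lemma open_prod_measurable (O : set (H * H)) : open O ->
  measurable (O : set (borel H * borel H)).
Proof.
move=> oO.
have [S cS dS] := Hsep.
pose Q := [set q : H * H * rat | [/\ S q.1.1, S q.1.2 &
  ball q.1.1 (ratr q.2 : R) `*` ball q.1.2 (ratr q.2) `<=` O]].
have -> : O = \bigcup_(q in Q)
    (ball q.1.1 (ratr q.2 : R) `*` ball q.1.2 (ratr q.2)).
  apply/seteqP; split => [[x y] Oxy|z [q [_ _]]]; last exact.
  have /nbhs_ballP[e /= e0 eO] := open_nbhs_nbhs (conj oO Oxy).
  have e4 : 0 < e / 4 by rewrite divr_gt0.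
  have e42 : e / 4 < e / 2 by lra.
  (* With the centre within [e / 4] of the point, a radius above [e / 4] captures the point, and one
     below [e / 2] keeps the ball inside that of radius [e]. *)
  have [q /[!in_itv]/= /andP[qe1 qe2]] := rat_in_itvoo e42.
  have near z : exists2 s, S s & ball s (ratr q) z /\ ball s (e/4) z.
    have [s [zs Ss]] := dS (ball z (e / 4)) (ex_intro _ z (ballxx z e4))
      (ball_open z (e / 4)).
    exists s => //; split; last exact: ball_sym.
    apply: ball_sym; apply: le_ball zs; exact: ltW.
  have [s Ss [xs xs']] := near x; have [t St [yt yt']] := near y.
  exists (s, t, q) => //; split => //= -[u v] [/= us vt].
  apply: eO; split => /=.
  - apply: (@le_ball _ _ _ (e / 4 + ratr q)); first by lra.
    by apply: ball_triangle us; exact: ball_sym.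
  - apply: (@le_ball _ _ _ (e / 4 + ratr q)); first by lra.
    by apply: ball_triangle vt; exact: ball_sym.
have cQ : countable Q.
  have cSS : countable ((S `*` S) `*` [set: rat]).
    by apply: countableX => //; exact: countableX.
  by apply: sub_countable cSS; apply: subset_card_le => q [].
rewrite bigcup_set_type.
apply: (@countable_bigcupT_measurable _ (borel H * borel H)%type).
  by rewrite (eq_countable (card_setT _)).
move=> q; apply: measurableX; apply: sub_sigma_algebra; exact: ball_open.
Qed.

Lemma continuous_measurable_pair d (T : measurableType d) (phi : H * H -> R)
    (g1 g2 : T -> borel H) :
  continuous phi -> measurable_fun setT g1 -> measurable_fun setT g2 ->
  measurable_fun setT (fun t => phi (g1 t, g2 t)).
Proof.
move=> cphi mg1 mg2.
apply: (measurability _ (RGenOInfty.measurableE R)) => _ [_ [x ->] <-].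
have mO : measurable (phi @^-1` `]x, +oo[ : set (borel H * borel H)).
  by apply: open_prod_measurable; apply: open_comp => // u _; exact: cphi.
have := measurable_fun_pair mg1 mg2; move=> /(_ measurableT _ mO).
by rewrite !setTI.
Qed.

Lemma normB_continuous : continuous (fun u : H * H => `|u.1 - u.2|).
Proof. by move=> u; apply: cvg_norm; apply: cvgB; [exact: cvg_fst|exact: cvg_snd]. Qed.

Lemma measurable_normB d (T : measurableType d) (g1 g2 : T -> borel H) :
  measurable_fun setT g1 -> measurable_fun setT g2 ->
  measurable_fun setT (fun t => `|g1 t - g2 t| : R).
Proof. exact: continuous_measurable_pair normB_continuous. Qed.

End borel_product.

Section weak_integral.
Context (R : realType) (H : completeNormedModType R) (ip : {dot H for (@idfun R)}).
Hypothesis Hhilbert : hilbert_norm ip.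
Hypothesis Hsep : separable H.
Context d (T : measurableType d) (mu : probability T R).

Lemma measurable_ip (g1 g2 : T -> borel H) :
  measurable_fun setT g1 -> measurable_fun setT g2 ->
  measurable_fun setT (fun t => ip (g1 t) (g2 t)).
Proof.
exact: (continuous_measurable_pair Hsep (ip_continuous Hhilbert)).
Qed.

Lemma simple_fun_measurable (s : T -> H) : simple_fun s ->
  measurable_fun setT (s : T -> borel H).
Proof.
move=> [fs ms] _ B _; rewrite setTI.
rewrite (_ : _ @^-1` _ = \bigcup_(y in range s `&` B) (s @^-1` [set y])).
  by apply: fin_bigcup_measurable => //; exact: finite_setIl.
apply/seteqP; split => [t Bt|t [y [_ By] /= ->//]].
by exists (s t) => //; split => //; exists t.
Qed.

Lemma simple_fun_weak_integral (s : T -> H) (u : H) : simple_fun s ->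
  mu.-integrable setT (fun t => (ip u (s t))%:E) /\
  (\int[mu]_t (ip u (s t))%:E = (ip u (simple_integral mu s))%:E)%E.
Proof.
move=> [fs ms].
pose h (y : H) (t : T) : \bar R := ((ip u y)%:E * (\1_(s @^-1` [set y]) t)%:E)%E.
have hE t : (ip u (s t))%:E = (\sum_(y <- fset_set (range s)) h y t)%E.
  rewrite (bigD1_seq (s t))/=; last exact: fset_uniq.
    rewrite big1 ?adde0; first by rewrite /h indicE mem_set// mule1.
    by move=> y /eqP yst; rewrite /h indicE memNset ?mule0// => /= E; apply: yst.
  by rewrite in_fset_set//; apply/mem_set; exists t.
have ih y : mu.-integrable setT (h y).
  by apply: integrableZl => //; exact: integrable_indic.
split.
  have -> : (fun t => (ip u (s t))%:E) =
      (fun t => \sum_(y <- fset_set (range s)) h y t)%E by apply/funext.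
  exact: integrable_sum.
under eq_integral do rewrite hE.
rewrite integral_sum//.
rewrite /simple_integral fsbig_finite//= linear_sumr/= -sumEFin.
apply: eq_bigr => y _.
rewrite /h integralZl//; last exact: integrable_indic.
by rewrite integral_indic// setIT linearZr/= EFinM muleC fineK ?fin_num_measure.
Qed.

(** Reduces the vector integral to scalar ones. Pairing with [u] is Lipschitz by Cauchy-Schwarz, so
    the integrals of the paired simple functions tend both to [ip u v] and to the integral of the
    pairing. *)
Lemma bochner_weak_integral (g : T -> H) (v u : H) : is_bochner_integral mu g v ->
  mu.-integrable setT (fun t => (ip u (g t))%:E) /\
  (\int[mu]_t (ip u (g t))%:E = (ip u v)%:E)%E.
Proof.
move=> [mg [s [ss sg sv]]].
have msk k := simple_fun_measurable (ss k).
have mn k : measurable_fun setT (fun t => `|g t - s k t|).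
  exact: measurable_normB.
have mip : measurable_fun setT (fun t => ip u (g t)) by exact: measurable_ip.
have mips k : measurable_fun setT (fun t => ip u (s k t)) by exact: measurable_ip.
have le_norm k t : `|ip u (g t) - ip u (s k t)| <= `|u| * `|g t - s k t|.
  by rewrite -linearBr; exact: hilbert_CauchySchwarz.
have in_ k : (\int[mu]_t (`|g t - s k t|)%:E < +oo)%E ->
    mu.-integrable setT (fun t => (`|g t - s k t|)%:E).
  move=> foo; apply/integrableP; split; first exact/measurable_EFinP.
  by under eq_integral do rewrite abse_EFin normr_id.
have id_ k : (\int[mu]_t (`|g t - s k t|)%:E < +oo)%E ->
    mu.-integrable setT (fun t => (ip u (g t) - ip u (s k t))%:E).
  move=> /in_ /(integrableZl measurableT `|u|); apply: le_integrable => //.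
    by apply/measurable_EFinP; exact: measurable_funB.
  by move=> t _ /=; rewrite lee_fin (le_trans (le_norm k t))// ler_norm.
(* Convergence to 0 in the extended reals permits infinite values early on. Once the error is below
   1 it is finite, and adding [s k] back gives integrability. *)
have near1 : \forall k \near \oo, (\int[mu]_t (`|g t - s k t|)%:E < 1)%E.
  have : nbhs (0 : \bar R) [set x | x < 1]%E.
    by apply: open_nbhs_nbhs; split; [exact: open_ereal_lt_ereal|exact: lte01].
  exact: sg.
have ig : mu.-integrable setT (fun t => (ip u (g t))%:E).
  have [k _ /(_ _ (leqnn k)) k1] := near1.
  have [is_ _] := simple_fun_weak_integral u (ss k).
  have := integrableD measurableT (id_ k (lt_trans k1 (ltry _))) is_.
  by apply: eq_integrable => // t _; rewrite /= -EFinD subrK.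
split => //.
have Lfin : (\int[mu]_t (ip u (g t))%:E)%E \is a fin_num by exact: integrable_fin_num.
rewrite -(fineK Lfin); congr EFin.
set L := fine _.
have bound : \forall k \near \oo, `|L - ip u (simple_integral mu (s k))| <=
    `|u| * fine (\int[mu]_t (`|g t - s k t|)%:E)%E.
  apply: filterS near1 => k k1.
  have koo := lt_trans k1 (ltry 1).
  have [is_ Is] := simple_fun_weak_integral u (ss k).
  have nfin : (\int[mu]_t (`|g t - s k t|)%:E)%E \is a fin_num.
    by apply: integrable_fin_num => //; exact: in_.
  rewrite -lee_fin EFinM fineK// -integralZl//; last exact: in_.
  have -> : (`|L - ip u (simple_integral mu (s k))|%:E =
      `|\int[mu]_t (ip u (g t) - ip u (s k t))%:E|)%E.
    under eq_integral do rewrite EFinB.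
    by rewrite integralB// Is -(fineK Lfin) -EFinB.
  apply: le_trans (le_abse_integral _ _ _) _ => //.
    exact: measurable_int (id_ k koo).
  apply: ge0_le_integral => //.
  - by apply: measurableT_comp => //; exact: measurable_int (id_ k koo).
  - by apply: measurable_int (integrableZl measurableT `|u| (in_ k koo)).
  - by move=> t _; rewrite -EFinM abse_EFin lee_fin.
have c1 : ip u (simple_integral mu (s k)) @[k --> \oo] --> ip u v.
  have c0 : (u, simple_integral mu (s k)) @[k --> \oo] --> (u, v).
    by apply: cvg_pair => //; exact: cvg_cst.
  exact: (cvg_comp _ _ c0 (@ip_continuous _ _ _ Hhilbert (u, v))).
have c2 : ip u (simple_integral mu (s k)) @[k --> \oo] --> L.
  have c0 : `|u| * fine (\int[mu]_t (`|g t - s k t|)%:E)%E @[k --> \oo] --> 0.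
    rewrite -(mulr0 `|u|); apply: cvgM; first exact: cvg_cst.
    exact: fine_cvg.
  apply/cvgrPdist_lt => e e0.
  apply: filterS2 bound ((cvgrPdist_lt _ _).1 c0 _ e0) => k /le_lt_trans + h.
  by apply; apply: le_lt_trans h; rewrite sub0r normrN ler_norm.
by rewrite -(cvg_lim _ c1)// -(cvg_lim _ c2).
Qed.

End weak_integral.

Lemma integral_probability_cst d (T : measurableType d) (R : realType)
    (mu : probability T R) (c : R) : (\int[mu]_t c%:E = c%:E)%E.
Proof.
rewrite -[LHS]/(\int[mu]_t cst c%:E t)%E integral_cst//.
by rewrite -[RHS]mule1; congr (_ * _)%E; exact: probability_setT.
Qed.

(** * The radial noise and its local moment bounds *)

Section mean_field.
Context (R : realType) (H : completeNormedModType R) (ip : {dot H for (@idfun R)}).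
Hypothesis Hhilbert : hilbert_norm ip.
Hypothesis Hsep : separable H.
Context d (chi : measurableType d) (mu : probability chi R).
Variables (F : H * chi -> H) (f : H -> H) (xstar : H).
Hypothesis F_measurable :
  measurable_fun [set: borel H * chi] (F : borel H * chi -> borel H).
Hypothesis f_def : forall x, is_bochner_integral mu (fun z => F (x, z)) (f x).

(** The part of [F] that enters the squared distance to [xstar] at first order in the step size. *)
Definition radial (u : borel H * chi) : R := ip (u.1 - xstar) (F u).

Definition mean_radial (x : borel H) : R := ip (x - xstar) (f x).

Lemma measurable_radial : measurable_fun setT radial.
Proof.
rewrite (_ : radial = fun u => ip u.1 (F u) - ip xstar (F u)); last first.
  by apply/funext => u; rewrite /radial linearBl.
by apply: measurable_funB; apply: (measurable_ip Hhilbert Hsep).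
Qed.

Lemma radial_integral x :
  mu.-integrable setT (fun z => (radial (x, z))%:E) /\
  (\int[mu]_z (radial (x, z))%:E = (mean_radial x)%:E)%E.
Proof. exact: (bochner_weak_integral Hhilbert Hsep (x - xstar) (f_def x)). Qed.

(** [f] is given only pointwise, by its integrals. Measurability in [x] comes from Tonelli applied
    to the positive and negative parts of [radial]. *)
Lemma measurable_mean_radial : measurable_fun setT mean_radial.
Proof.
apply/measurable_EFinP.
have mr : measurable_fun [set: borel H * chi] (EFin \o radial).
  by apply/measurable_EFinP; exact: measurable_radial.
rewrite (_ : EFin \o mean_radial = fun x : borel H =>
  (\int[mu]_z (EFin \o radial)^\+ (x, z) - \int[mu]_z (EFin \o radial)^\- (x, z))%E).
  apply: emeasurable_funB.
    by apply: measurable_fun_fubini_tonelli_F => //; exact: measurable_funepos.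
  by apply: measurable_fun_fubini_tonelli_F => //; exact: measurable_funeneg.
apply/funext => x /=; rewrite -(radial_integral x).2 integralE.
by congr (_ - _)%E; apply: eq_integral => z _; rewrite ?funeposE ?funenegE.
Qed.

Variable rho : R.

Let near_xstar (x : borel H) : bool := `|x - xstar| < rho.

Let measurable_near_xstar : measurable_fun setT near_xstar.
Proof.
apply: measurable_fun_ltr => //.
by apply: (measurable_normB Hsep) => //; exact: measurable_cst.
Qed.

(** The cutoff looks at [u.1] only, so the mean over the noise stays 0 for each fixed position. *)
Definition local_noise (u : borel H * chi) : R :=
  if near_xstar u.1 then radial u - mean_radial u.1 else 0.

Definition local_sqnorm (u : borel H * chi) : R :=
  if near_xstar u.1 then `|F u| ^+ 2 else 0.

Lemma measurable_local_noise : measurable_fun setT local_noise.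
Proof.
apply: measurable_fun_ifT => //.
- exact: (measurableT_comp measurable_near_xstar measurable_fst).
- apply: measurable_funB; first exact: measurable_radial.
  exact: (measurableT_comp measurable_mean_radial measurable_fst).
Qed.

Lemma measurable_sqnorm : measurable_fun setT (fun u : borel H * chi => `|F u| ^+ 2).
Proof.
apply: measurable_funX.
rewrite (_ : (fun u => _) = fun u : borel H * chi => `|F u - 0|); last first.
  by apply/funext => u; rewrite subr0.
by apply: (measurable_normB Hsep) => //; exact: measurable_cst.
Qed.

Lemma measurable_local_sqnorm : measurable_fun setT local_sqnorm.
Proof.
apply: measurable_fun_ifT => //; last exact: measurable_sqnorm.
exact: (measurableT_comp measurable_near_xstar measurable_fst).
Qed.

Lemma local_sqnorm_ge0 u : 0 <= local_sqnorm u.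
Proof. by rewrite /local_sqnorm; case: ifP => // _; rewrite sqr_ge0. Qed.

Lemma local_noise_mean0 x : (\int[mu]_z (local_noise (x, z))%:E = 0)%E.
Proof.
have [xr|/negbTE xr] := boolP (near_xstar x); last first.
  by under eq_integral do rewrite /local_noise/= xr; rewrite integral0.
under eq_integral do rewrite /local_noise/= xr.
have [ir Ir] := radial_integral x.
under eq_integral do rewrite EFinB.
rewrite integralB//; last exact: finite_measure_integrable_cst.
by rewrite Ir integral_probability_cst subee.
Qed.

Variable M : R.
Hypothesis M_ge0 : 0 <= M.
Hypothesis F_sqnorm : forall x, `|x - xstar| < rho ->
  (\int[mu]_z (`|F (x, z)| ^+ 2)%:E <= M%:E)%E.

Lemma local_sqnorm_mean x : (\int[mu]_z (local_sqnorm (x, z))%:E <= M%:E)%E.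
Proof.
have [xr|/negbTE xr] := boolP (near_xstar x).
  by under eq_integral do rewrite /local_sqnorm/= xr; exact: F_sqnorm.
by under eq_integral do rewrite /local_sqnorm/= xr; rewrite integral0 lee_fin.
Qed.

Lemma local_noise_variance : exists C, forall x,
  (\int[mu]_z ((local_noise (x, z)) ^+ 2)%:E <= C%:E)%E.
Proof.
(* [radial] is at most [rho] times the norm of [F], so [t <= 1 + t ^+ 2] bounds its mean by [c]. The
   final constant comes from [(p - q) ^+ 2 <= 2 * p ^+ 2 + 2 * q ^+ 2]. *)
pose c := 1 + rho ^+ 2 * M.
exists (2 * rho ^+ 2 * M + 2 * c ^+ 2) => x.
have C0 : 0 <= 2 * rho ^+ 2 * M + 2 * c ^+ 2.
  have r2 := sqr_ge0 rho; have c2 := sqr_ge0 c.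
  by rewrite -mulrA; apply: addr_ge0; apply: mulr_ge0 => //; exact: mulr_ge0.
have [xr|/negbTE xr] := boolP (near_xstar x); last first.
  under eq_integral do rewrite /local_noise/= xr expr0n/=.
  by rewrite integral0 lee_fin.
under eq_integral do rewrite /local_noise/= xr.
have [ir Ir] := radial_integral x.
have mFx : measurable_fun setT (fun z => (`|F (x, z)| ^+ 2)%:E).
  apply/measurable_EFinP.
  exact: (measurable_fun_pair2 _ measurable_sqnorm).
have mrx : measurable_fun setT (fun z => radial (x, z)).
  exact: (measurable_fun_pair2 _ measurable_radial).
have rho0 : 0 < rho by exact: le_lt_trans xr.
have radial_le z : `|radial (x, z)| <= rho * `|F (x, z)|.
  apply: le_trans (hilbert_CauchySchwarz Hhilbert _ _) _.
  by rewrite ler_wpM2r//; exact: ltW.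
have radial2_le z : radial (x, z) ^+ 2 <= rho ^+ 2 * `|F (x, z)| ^+ 2.
  rewrite -[leLHS]real_normK ?num_real// -exprMn ler_pXn2r// nnegrE//.
  by rewrite mulr_ge0// ltW.
have I2 : (\int[mu]_z (rho ^+ 2 * `|F (x, z)| ^+ 2)%:E <= (rho ^+ 2 * M)%:E)%E.
  under eq_integral do rewrite EFinM.
  rewrite ge0_integralZl//; last by rewrite lee_fin sqr_ge0.
  by rewrite [leRHS]EFinM lee_wpmul2l ?lee_fin ?sqr_ge0//; exact: F_sqnorm.
have mF2 : measurable_fun setT (fun z => (rho ^+ 2 * `|F (x, z)| ^+ 2)%:E).
  by under eq_fun do rewrite EFinM; exact: measurable_funeM.
have hc : `|mean_radial x| <= c.
  rewrite -lee_fin -abse_EFin -Ir.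
  apply: le_trans (le_abse_integral _ _ _) _ => //; first exact/measurable_EFinP.
  apply: (@le_trans _ _ (\int[mu]_z (1%:E + (rho ^+ 2 * `|F (x, z)| ^+ 2)%:E)%E)%E).
    apply: ge0_le_integral => //.
    - by apply: measurableT_comp => //; exact/measurable_EFinP.
    - by apply: emeasurable_funD.
    - move=> z _; rewrite abse_EFin -EFinD lee_fin.
      have := radial2_le z; rewrite -[X in X <= _ -> _]real_normK ?num_real//.
      nra.
  rewrite ge0_integralD//; last by move=> z _; rewrite lee_fin mulr_ge0// sqr_ge0.
  by rewrite integral_probability_cst [leRHS]EFinD leeD2l.
apply: (@le_trans _ _ (\int[mu]_z (2%:E * (rho ^+ 2 * `|F (x, z)| ^+ 2)%:E +
    (2 * c ^+ 2)%:E)%E)%E).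
  apply: ge0_le_integral => //.
  - by move=> z _; rewrite lee_fin sqr_ge0.
  - by apply/measurable_EFinP; apply: measurable_funX; exact: measurable_funB.
  - by apply: emeasurable_funD => //; exact: measurable_funeM.
  - move=> z _; rewrite -EFinM -EFinD lee_fin.
    have h2 : mean_radial x ^+ 2 <= c ^+ 2.
      rewrite -[leLHS]real_normK ?num_real// ler_pXn2r// nnegrE.
      exact: le_trans hc.
    have := radial2_le z; have := sqr_ge0 (radial (x, z) + mean_radial x); nra.
rewrite ge0_integralD//; last 3 first.
- by move=> z _; apply: mule_ge0 => //; rewrite lee_fin mulr_ge0// sqr_ge0.
- exact: measurable_funeM.
- by move=> z _; rewrite lee_fin mulr_ge0// sqr_ge0.
rewrite integral_probability_cst [leRHS]EFinD leeD2r//.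
rewrite ge0_integralZl//; last by move=> z _; rewrite lee_fin mulr_ge0// sqr_ge0.
by rewrite -mulrA [leRHS]EFinM lee_wpmul2l// lee_fin.
Qed.

End mean_field.

(** * Step-size series and the convergence theorem *)

Lemma shift_sum_cvg_pinfty (R : realType) (a : nat -> R) :
  (forall n, (1 <= n)%N -> 0 < a n) -> (\sum_(1 <= n <oo) (a n)%:E = +oo)%E ->
  (fun n => \sum_(0 <= k < n) a k.+1) @ \oo --> +oo.
Proof.
move=> a0 asum; apply/cvgeryP.
have c : cvgn (fun n => (\sum_(1 <= k < n) (a k)%:E)%E).
  by apply: is_cvg_nneseries => n n1 _; rewrite lee_fin ltW// a0.
have : (\sum_(1 <= k < n) (a k)%:E)%E @[n --> \oo] --> +oo%E by rewrite -asum.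
rewrite -(cvg_shiftS (fun n => (\sum_(1 <= k < n) (a k)%:E)%E)).
by under eq_fun do rewrite big_add1/= sumEFin.
Qed.

Lemma shift_series_lty (R : realType) (u : nat -> R) : (forall n, 0 <= u n) ->
  (\sum_(1 <= n <oo) (u n)%:E < +oo)%E -> (\sum_(0 <= n <oo) (u n.+1)%:E < +oo)%E.
Proof.
move=> u0; congr (_ < _)%E; apply/esym/cvg_lim => //.
have : (\sum_(1 <= k < n) (u k)%:E)%E @[n --> \oo] --> (\sum_(1 <= k <oo) (u k)%:E)%E.
  by apply: is_cvg_nneseries => n _ _; rewrite lee_fin.
rewrite -(cvg_shiftS (fun n => (\sum_(1 <= k < n) (u k)%:E)%E)).
by under eq_fun do rewrite big_add1/=.
Qed.

Theorem theorem2p2 (R : realType)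
  (H : completeNormedModType R) (ip : {dot H for (@idfun R)})
  (Hhilbert : hilbert_norm ip) (Hsep : separable H)
  (d d' : measure_display) (W : measurableType d) (P : probability W R)
  (chi : measurableType d')
  (Z0 : {RV P >-> chi})
  (F : H * chi -> H)
  (F_measurable :
     measurable_fun [set: borel H * chi] (F : borel H * chi -> borel H))
  (f : H -> H)
  (f_def : forall x,
     is_bochner_integral (distribution P Z0) (fun z => F (x, z)) (f x))
  (Z : nat -> {RV P >-> chi})
  (Z_iid : iid_noise (distribution P Z0) Z)
  (a : nat -> R)
  (U : nat -> set H)
  (X Xt : nat -> W -> H) (sigma : nat -> W -> nat)
  (Halg : truncated_robbins_monro U a F Z X Xt sigma)
  (xstar : H) (f_zero : f xstar = 0)
  (r : nat -> R)
  (r0_gt0 : 0 < r 0%N) (r_incr : forall n, r n < r n.+1)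
  (r_infty : r n @[n --> \oo] --> +oo)
  (U_ball : forall n, U n = ball (0 : H) (r n))
  (f_drift : forall b A : R, 0 < b -> b < A ->
     exists2 delta : R, 0 < delta &
       (delta%:E <= ereal_inf [set (ip (x - xstar) (f x))%:E
                              | x in [set x : H | (b <= `|x - xstar| <= A)%R]])%E)
  (F_bounded : forall B : set H, bounded_set B ->
     exists M : R, forall x, B x ->
       ('E_P[fun w => (`|F (x, Z0 w)| ^+ 2)%R] <= M%:E)%E)
  (a_gt0 : forall n, (1 <= n)%N -> 0 < a n)
  (a_sum : (\sum_(1 <= n <oo) (a n)%:E = +oo)%E)
  (a_sum2 : (\sum_(1 <= n <oo) ((a n) ^+ 2)%:E < +oo)%E) :
  {ae P, forall w, X n w @[n --> \oo] --> xstar} /\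
  {ae P, forall w,
    (ereal_sup [set ((sigma n w)%:R : R)%:E | n in [set: nat]] < +oo)%E}.
Proof.
have [_ mX0 X0_in X0_indep _ Xt_step accept [Xres Xres_in truncate] adapted] := Halg.
have [Z_law Z_indep] := Z_iid.
pose mu : probability chi R := distribution P Z0.
pose G := history_generator (X 0%N) Z.
pose h := mean_radial ip f xstar.
pose noise (rho : nat) := local_noise ip F f xstar rho%:R.
pose sqnorm (rho : nat) := local_sqnorm F xstar rho%:R.
have X_adapted k : measurable_fun [set: g_sigma_algebraType (G k)] (X k : W -> borel H).
  by move=> _ B mB; rewrite setTI; exact: adapted.
have Z_adapted k : measurable_fun [set: g_sigma_algebraType (G k.+1)] (Z k.+1).
  move=> _ B mB; rewrite setTI; apply: sub_sigma_algebra; right.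
  by exists k.+1 => /=; [rewrite leqnn|exists B => //; rewrite setTI].
have Gm k : G k `<=` measurable by exact: history_generator_measurable.
have G_mono k : <<s G k >> `<=` <<s G k.+1 >> by exact: history_sigma_le.
have indep k A B : <<s G k >> A -> measurable B ->
    P (A `&` Z k.+1 @^-1` B) = (P A * P (Z k.+1 @^-1` B))%E.
  exact: history_noise_independent.
have F_sqnorm (rho : nat) : exists2 M : R, 0 <= M & forall x, `|x - xstar| < rho%:R ->
    (\int[mu]_z (`|F (x, z)| ^+ 2)%:E <= M%:E)%E.
  have [|M hM] := F_bounded [set x | `|x - xstar| < rho%:R].
    exists (rho%:R + `|xstar|); split; first exact: num_real.
    move=> K ltK x /= xr; apply: le_trans (ltW ltK).
    have := ler_normD (x - xstar) xstar; rewrite subrK => /le_trans; apply.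
    by rewrite lerD2r ltW.
  (* For [rho = 0] the ball is empty and [M] could be negative, whereas the moment bounds require a
     nonnegative constant. *)
  exists (Num.max 0 M) => [|x xr]; first by rewrite le_max lexx.
  apply: (@le_trans _ _ M%:E); last by rewrite lee_fin le_max lexx orbT.
  rewrite ge0_integral_distribution//=; last first.
    apply/measurable_EFinP.
    exact: (measurable_fun_pair2 _ (measurable_sqnorm Hsep F_measurable)).
  by apply: le_trans (hM x xr); rewrite unlock.
have a2_sum : (\sum_(0 <= k <oo) ((a k.+1) ^+ 2)%:E < +oo)%E.
  by apply: (@shift_series_lty _ (fun k => (a k) ^+ 2)) => // k; exact: sqr_ge0.
(* Summability of the squared steps controls both series, the first through its variances and the
   second through its expectation. *)
have noise_cvg : {ae P, forall w (rho : nat),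
    cvgn (fun n => \sum_(0 <= k < n) a k.+1 * noise rho (X k w, Z k.+1 w)) /\
    cvgn (fun n => \sum_(0 <= k < n) (a k.+1) ^+ 2 * sqnorm rho (X k w, Z k.+1 w))}.
  apply: ae_foralln => rho.
  have [M M0 FM] := F_sqnorm rho.
  have [C HC] := local_noise_variance Hhilbert Hsep F_measurable f_def M0 FM.
  have mn : measurable_fun [set: borel H * chi] (noise rho).
    exact: measurable_local_noise.
  have ms : measurable_fun [set: borel H * chi] (sqnorm rho).
    exact: measurable_local_sqnorm.
  have n0 x : (\int[mu]_z (noise rho (x, z))%:E = 0)%E.
    exact: (local_noise_mean0 Hhilbert Hsep).
  have c1 := @fresh_noise_martingale_cvg _ W R P _ (borel H) _ chi G X Z mu Gm G_mono
    X_adapted Z_adapted Z_law indep (noise rho) C (fun k => a k.+1) mn HC n0 a2_sum.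
  have c2 := @fresh_noise_series_cvg _ W R P _ (borel H) _ chi G X Z mu Gm G_mono
    X_adapted Z_adapted Z_law indep (sqnorm rho) M (fun k => (a k.+1) ^+ 2) ms
    (local_sqnorm_ge0 F xstar rho%:R) (fun k => sqr_ge0 (a k.+1))
    (local_sqnorm_mean M0 FM) a2_sum.
  by apply: filterS2 c1 c2 => w; split.
have h_drift b A : 0 < b -> b < A -> exists2 delta, 0 < delta &
    forall x, b <= `|x - xstar| <= A -> delta <= h x.
  move=> b0 bA; have [delta delta0 Hd] := f_drift b A b0 bA.
  exists delta => // x xbA; rewrite -lee_fin; apply: le_trans Hd _.
  by apply: ereal_inf_lbound; exists x.
have h_ge0 (x : H) : 0 <= h x.
  have [->|xs] := eqVneq x xstar; first by rewrite /h /mean_radial subrr linear0l.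
  have x0 : 0 < `|x - xstar| by rewrite normr_gt0 subr_eq0.
  (* Any shell having [x] on its inner sphere gives the sign; the outer radius only has to be
     larger. *)
  have [|delta d0 Hd] := h_drift `|x - xstar| (`|x - xstar| + 1) x0.
    by rewrite ltrDl.
  apply: (le_trans (ltW d0)); apply: Hd.
  by rewrite lexx lerDl ler01.
(* What is left of the expanded square after removing the drift [a k.+1 * (2 * h (X k w))]. Both
   cut-off functions vanish outside radius [rho], so [e] is 0 there. *)
pose e w rho k := (a k.+1) ^+ 2 * sqnorm rho (X k w, Z k.+1 w) -
  2 * (a k.+1 * noise rho (X k w, Z k.+1 w)).
have e_cvg w : (forall rho : nat,
    cvgn (fun n => \sum_(0 <= k < n) a k.+1 * noise rho (X k w, Z k.+1 w)) /\
    cvgn (fun n => \sum_(0 <= k < n) (a k.+1) ^+ 2 * sqnorm rho (X k w, Z k.+1 w))) ->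
    forall rho, cvgn (fun n => \sum_(0 <= k < n) e w rho k).
  move=> hw rho; have [c1 c2] := hw rho.
  under eq_fun do rewrite /e sumrB -mulr_sumr.
  by apply: is_cvgB => //; apply: is_cvgMr.
have proposal w rho k : `|X k w - xstar| < rho%:R ->
    `|Xt k.+1 w - xstar| ^+ 2 =
    `|X k w - xstar| ^+ 2 - a k.+1 * (2 * h (X k w)) + e w rho k.
  move=> xr.
  rewrite /e /sqnorm /noise /local_sqnorm /local_noise /= xr /radial /= -/(h (X k w)).
  have -> : Xt k.+1 w - xstar = (X k w - xstar) - a k.+1 *: F (X k w, Z k.+1 w).
    by rewrite Xt_step addrAC.
  rewrite [LHS](hilbert_normB Hhilbert) (ipZr ip) normrZ exprMn.
  rewrite [ `|a k.+1| ^+ 2]real_normK ?num_real//; ring.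
have path w (hw : forall rho, cvgn (fun n => \sum_(0 <= k < n) e w rho k)) :
    (X n w @[n --> \oo] --> xstar) /\ exists B, forall n, (sigma n w <= B)%N.
  have acc n : ball (0 : H) (r (sigma n w)) (Xt n.+1 w) ->
      X n.+1 w = Xt n.+1 w /\ sigma n.+1 w = sigma n w.
    by rewrite -U_ball; exact: accept.
  have trunc n : ~ ball (0 : H) (r (sigma n w)) (Xt n.+1 w) ->
      X n.+1 w = Xres (sigma n w) w /\ sigma n.+1 w = (sigma n w).+1.
    by rewrite -U_ball; exact: truncate.
  have x0 : ball (0 : H) (r 0%N) (X 0%N w) by rewrite -U_ball.
  have xres k : ball (0 : H) (r 0%N) (Xres k w) by rewrite -U_ball.
  have h2_ge0 (x : H) : 0 <= 2 * h x by rewrite mulr_ge0.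
  have h2_drift b A : 0 < b -> b < A -> exists2 delta, 0 < delta &
      forall x, b <= `|x - xstar| <= A -> delta <= 2 * h x.
    move=> b0 bA; have [delta d0 Hd] := h_drift b A b0 bA.
    by exists delta => // x /Hd; have := h_ge0 x; lra.
  have ap n : 0 < a n.+1 by exact: a_gt0.
  have asum := shift_sum_cvg_pinfty a_gt0 a_sum.
  split.
    apply: (@truncated_path_cvg _ _ (X^~ w) (Xt^~ w) (Xres^~ w) (sigma^~ w) r
      (fun n => a n.+1) xstar (fun x => 2 * h x) (e w)) => //; exact: proposal.
  apply: (@truncations_bounded _ _ (X^~ w) (Xt^~ w) (Xres^~ w) (sigma^~ w) r
    (fun n => a n.+1) xstar (fun x => 2 * h x) (e w)) => //; exact: proposal.
split; apply: filterS noise_cvg => w /e_cvg /path[].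
  by [].
move=> _ [B sB]; apply: (@le_lt_trans _ _ (B%:R : R)%:E); last exact: ltry.
by apply: ub_ereal_sup => _ [n _ <-]; rewrite lee_fin ler_nat.
Qed.
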